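(* Let $\nu\in\mathbb N$, and assume hypotheses (H1) and (H2) of the context on $(P_t)_{t\ge0}$ and $(Q_l)_{l\in\mathbb N}$, with parameters $\alpha>0$ and $\beta\in\mathbb N$. Let $\mathcal T_0^\nu$ be the tree, $\mathbf F(\mathcal T_0^\nu)$ the associated family of trees, $c(\mathcal A)$ the coefficients, $\Gamma_0^{\mathcal A}$ the random operators and $k(0,\nu)$ the integer defined in the context. Define $$\hat Q_T(\mathcal T_0^\nu)=Q_0+\sum_{\mathcal A\in\mathbf F(\mathcal T_0^\nu)}c(\mathcal A)\,\mathbb E[\Gamma_0^{\mathcal A}].$$ Then there is a constant $C>0$, independent of $n$ and $f$, such that for all $n\in\mathbb N^*$ with $n\ge\max_{u\in\mathcal T_0^\nu}j_u(\mathcal T_0^\nu)$ and all $f\in C_b^\infty(\mathbb R^d)$, $$\big\|(\hat Q_T(\mathcal T_0^\nu)-P_T)f\big\|_\infty\le C\,\|f\|_{k(0,\nu),\infty}\,n^{-\nu}.$$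
   Context: Notation: $\mathbb N=\{0,1,2,\dots\}$, $\mathbb N^*=\mathbb N\setminus\{0\}$, $\lceil x\rceil$ is the ceiling. $C_b^\infty(\mathbb R^d)$ is the space of smooth functions $\mathbb R^d\to\mathbb R^d$ which are bounded with bounded derivatives of all orders, and $\|f\|_{k,\infty}=\sum_{0\le|\gamma|\le k}\sup_x|\partial^\gamma f(x)|$, $\|f\|_\infty=\|f\|_{0,\infty}$. For non-commuting operators, $\prod_{j=1}^iA_j=A_i\cdots A_1$. Setting: $T>0$ is fixed; for $n\in\mathbb N^*$, $l\in\mathbb N$, $h_l=T/n^l$. $(P_t)_{t\ge0}$ is a semigroup of linear operators on $C_b^\infty(\mathbb R^d)$ ($P_{t+s}=P_tP_s$, $P_0=\mathrm{Id}$). For each $n$, $Q_l:C_b^\infty(\mathbb R^d)\to C_b^\infty(\mathbb R^d)$, $l\in\mathbb N$, are linear operators (depending on $n$ through $h_l$), and $Q_l^{[k]}$ is the $k$-fold composition of $Q_l$ ($Q_l^{[0]}=\mathrm{Id}$). (H1): for all $l,k\in\mathbb N$ there is $C>0$ (independent of $n$) such that for all $f\in C_b^\infty(\mathbb R^d)$, $\|(P_{h_l}-Q_l)f\|_{k,\infty}\le C\|f\|_{k+\beta,\infty}h_l^{1+\alpha}$. (H2): for all $l,m\in\mathbb N$ there is $C>0$ (independent of $n$) such that for all $f\in C_b^\infty(\mathbb R^d)$, $\max_{0\le k\le n^l}\|Q_l^{[k]}f\|_{m,\infty}+\sup_{t\le T}\|P_tf\|_{m,\infty}\le C\|f\|_{m,\infty}$.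 Trees: let $\mathcal U=\bigcup_{m\ge0}(\mathbb N^* )^m$, let $\emptyset$ be the empty sequence (the root, or ancestor), and for $u=(u_1,\dots,u_m)$ let $iu=(i,u_1,\dots,u_m)$, $ui=(u_1,\dots,u_m,i)$. A (finite) tree is a finite $\mathcal T\subset\mathcal U$ with $\emptyset\in\mathcal T$; $uj\in\mathcal T\Rightarrow u\in\mathcal T$; and $uj\in\mathcal T\Rightarrow ui\in\mathcal T$ for $1\le i<j$. $j_u(\mathcal T)=\max\{i\in\mathbb N^*:ui\in\mathcal T\}$ ($0$ if there is none) is the number of sons of $u$; $\mathcal T_i'=\{u:iu\in\mathcal T\}$ is the subtree rooted at $i$; $i\mathcal T=\{iu:u\in\mathcal T\}$; leaves: $\mathcal E(\mathcal T)=\{u\in\mathcal T:j_u(\mathcal T)=0\}$. The trees $\mathcal T_l^\nu$: for $l,\nu\in\mathbb N$ and $i\in\mathbb N^*$ set $q_i(l,\nu)=\nu+\lceil i-(1+\alpha)(l+1)(i-1)\rceil$ and $m(l,\nu)=\lceil \nu/((1+\alpha)l+\alpha)\rceil$, and recursively $$\mathcal T_l^\nu=\{\emptyset\}\cup\bigcup_{i=1}^{m(l,\nu)-1}i\,\mathcal T_{l+1}^{q_i(l,\nu)}$$ (the union is empty if $m(l,\nu)\le1$; the recursion terminates and yields a finite tree). With the same (terminating) recursion, $k(l,\nu)=\max\big(\beta m(l,\nu),\max_{1\le i\le m(l,\nu)-1}i\,k(l+1,q_i(l,\nu))\big)$ (a maximum over an empty set is $0$). Family $\mathbf F(\mathcal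 T)$: for a set $\mathbb F$ of trees and $m\in\mathbb N^*$, $\mathbb F^{\otimes m}$ is the set of all trees $\{\emptyset\}\cup1\mathcal S_1\cup\dots\cup m\mathcal S_m$ with $\mathcal S_1,\dots,\mathcal S_m\in\mathbb F$. If $\mathcal T$ is the tree $\{\emptyset\}$ reduced to the root, $\mathbf F(\mathcal T)$ has that tree as its only element. Otherwise $\mathbf F(\mathcal T)$ consists of the one-point tree $\{\emptyset\}$ together with all elements of $(\mathbf F(\mathcal T_i'))^{\otimes i}$, $i=1,\dots,j_\emptyset(\mathcal T)$. Random trees: each tree $\mathcal A\in\mathbf F(\mathcal T)$ is labelled by independent random variables $\kappa(u)=(\kappa_1(u),\dots,\kappa_{j_u(\mathcal A)}(u))$, $u\in\mathcal A\setminus\mathcal E(\mathcal A)$, with $\kappa(u)$ uniform on $\{(k_1,\dots,k_{j_u(\mathcal A)}):0\le k_1<\dots<k_{j_u(\mathcal A)}\le n-1\}$. The subtree $\mathcal A_i'$ is labelled by $\kappa^i(v)=\kappa(iv)$. Random operators $\Gamma_l^{\mathcal A}$: if $\mathcal A=\{\emptyset\}$, $\Gamma_l^{\mathcal A}=Q_{l+1}^{[n]}-Q_l$. If $j_\emptyset(\mathcal A)=i\ge1$, with $(\kappa_1,\dots,\kappa_i)=\kappa(\emptyset)$, $\kappa_j'=\kappa_j+1$ for $j\ge1$ and $\kappa_0'=0$, $$\Gamma_l^{\mathcal A}=Q_{l+1}^{[n-\kappa_i']}\prod_{j=1}^i\Big(\Gamma_{l+1}^{\mathcal A_j'}\,Q_{l+1}^{[\kappa_j-\kappa_{j-1}']}\Big).$$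 Coefficients: $c(\mathcal A)=\prod_{u\in\mathcal A}\binom{n}{j_u(\mathcal A)}$. $\mathbb E$ is the (finite) average over the labels $\kappa$. *)

(* Defs.v *)
From HB Require Import structures.
From mathcomp Require Import all_boot all_order all_algebra finmap ring lra.
From mathcomp Require Import all_classical all_reals all_analysis.
Set Implicit Arguments.
Unset Strict Implicit.
Unset Printing Implicit Defensive.
Import Order.TTheory GRing.Theory Num.Theory numFieldNormedType.Exports.
Local Open Scope ring_scope.

Section Cb.
Context {R : realType} {d : nat}.
Implicit Types f g : 'rV[R]_d -> 'rV[R]_d.

Definition enorm (x : 'rV[R]_d) : R := Num.sqrt (\sum_(i < d) x 0 i ^+ 2).

Definition partial (i : 'I_d) f : 'rV[R]_d -> 'rV[R]_d :=
  fun x => 'D_(delta_mx 0 i) f x.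

Definition partials (s : seq 'I_d) f : 'rV[R]_d -> 'rV[R]_d :=
  foldr partial f s.

Definition smooth f : Prop := forall s : seq 'I_d,
  continuous (partials s f) /\
  forall i x, derivable (partials s f) x (delta_mx 0 i).

Definition bounded_partials f : Prop := forall s : seq 'I_d,
  exists M : R, forall x, enorm (partials s f x) <= M.

Definition cb_pred : {pred 'rV[R]_d -> 'rV[R]_d} :=
  [pred f | `[< smooth f /\ bounded_partials f >]].

Definition mpartial (gamma : 'I_d -> nat) f : 'rV[R]_d -> 'rV[R]_d :=
  partials (flatten [seq nseq (gamma i) i | i <- enum 'I_d]) f.

(* The multi-indices of length at most k have entries at most k. The real
   supremum is meaningful on $C_b^\infty$, whose elements have bounded
   derivatives. *)
Definition cbnorm (k : nat) f : R :=
  \sum_(gamma : {ffun 'I_d -> 'I_k.+1} | (\sum_i gamma i <= k)%N)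
    sup [set enorm (mpartial (fun i => gamma i) f x) | x in [set: 'rV[R]_d]].

Lemma enorm_ge0 (x : 'rV[R]_d) : 0 <= enorm x.
Proof. exact: sqrtr_ge0. Qed.

Lemma enorm0 : enorm 0 = 0.
Proof. by rewrite /enorm big1 ?sqrtr0// => i _; rewrite mxE expr0n. Qed.

Lemma enorm_bound (x : 'rV[R]_d) (M : R) : 0 <= M ->
  (forall i, `|x 0 i| <= M) -> enorm x <= Num.sqrt d%:R * M.
Proof.
move=> M0 h; rewrite -[leRHS]ger0_norm ?mulr_ge0 ?sqrtr_ge0//.
rewrite -sqrtr_sqr ler_wsqrtr// exprMn sqr_sqrtr ?ler0n//.
rewrite -[d in d%:R]card_ord mulr_natl -sumr_const ler_sum// => i _.
by rewrite -real_normK ?num_real// lerXn2r ?nnegrE.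
Qed.

Lemma coord_le_enorm (x : 'rV[R]_d) i : `|x 0 i| <= enorm x.
Proof.
rewrite -sqrtr_sqr ler_wsqrtr// (bigD1 i)//= lerDl.
by apply: sumr_ge0 => j _; exact: sqr_ge0.
Qed.

Lemma partials_linear a f g s : smooth f -> smooth g ->
  partials s (a *: f + g) = a *: partials s f + partials s g.
Proof.
move=> sf sg; elim: s => [//|i s ih] /=.
rewrite ih; apply/funext => x; rewrite /partial.
move: ((sf s).2 i x) ((sg s).2 i x).
move: (partials s f) (partials s g) (delta_mx 0 i) => F G v dF dG.
have daF : derivable (a \*: F) x v by exact: (@derivableZ _ _ _ F a).
exact: etrans (deriveD daF dG) (congr1 (+%R^~ _) (deriveZ a dF)).
Qed.

Lemma smooth0 s : partials s 0 = 0.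
Proof.
elim: s => [//|i s /= ->]; apply/funext => x.
rewrite /partial -[X in 'D__ X x]/(cst (0 : 'rV[R]_d)); exact: derive_cst.
Qed.

Lemma continuous_linear (a : R) f g :
  continuous f -> continuous g -> continuous (a *: f + g).
Proof.
move=> cf cg x; have c1 : {for x, continuous (a \*: f)}.
  by apply: continuousZl_tmp; exact: cf.
exact: (continuousD c1 (cg x)).
Qed.

Lemma derivable_linear (a : R) f g (x v : 'rV[R]_d) :
  derivable f x v -> derivable g x v -> derivable (a *: f + g) x v.
Proof.
move=> df dg; have d1 : derivable (a \*: f) x v.
  exact: (@derivableZ _ _ _ f a).
exact: (derivableD d1 dg).
Qed.

Lemma cb_submod_closed : submod_closed cb_pred.
Proof.
split.
  apply/asboolP; split=> s; rewrite smooth0.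
    split; first exact: (@cst_continuous _ _ (0 : 'rV[R]_d)).
    by move=> i x; exact: (derivable_cst (0 : 'rV[R]_d)).
  by exists 0 => x; rewrite enorm0.
move=> a f g /asboolP[sf bf] /asboolP[sg bg].
apply/asboolP; split=> s; rewrite partials_linear//.
  have [cf df] := sf s; have [cg dg] := sg s.
  split; first exact: continuous_linear.
  by move=> i x; apply: derivable_linear.
have [M hM] := bf s; have [N hN] := bg s.
exists (Num.sqrt d%:R * (`|a| * `|M| + `|N|)) => x.
apply: enorm_bound => [|i]; first by rewrite addr_ge0 ?mulr_ge0.
have -> : (a *: partials s f + partials s g) x 0 i =
    a * partials s f x 0 i + partials s g x 0 i.
  by rewrite -[(_ + _) x]/(a *: partials s f x + partials s g x) !mxE.
apply: le_trans (ler_normD _ _) _; apply: lerD.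
  rewrite normrM ler_wpM2l// (le_trans (coord_le_enorm _ _))//.
  exact: le_trans (hM x) (ler_norm _).
rewrite (le_trans (coord_le_enorm _ _))//.
exact: le_trans (hN x) (ler_norm _).
Qed.

HB.instance Definition _ :=
  GRing.isSubmodClosed.Build _ _ cb_pred cb_submod_closed.

Record Cb := MkCb { cbfun :> 'rV[R]_d -> 'rV[R]_d; _ : cbfun \in cb_pred }.

HB.instance Definition _ := [isSub for cbfun].
HB.instance Definition _ := [Choice of Cb by <:].
HB.instance Definition _ := [SubChoice_isSubLmodule of Cb by <:].

End Cb.
Arguments Cb : clear implicits.

Notation vertex := (seq nat).
Notation tree := {fset vertex}.

Definition root_tree : tree := [fset [::]]%fset.

Definition is_tree (T : tree) : Prop :=
  [/\ {in T, forall u, 0 \notin u}%N,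
      [::] \in T,
      forall u j, rcons u j \in T -> u \in T
    & forall u i j, (0 < i < j)%N -> rcons u j \in T -> rcons u i \in T].

(* $j_u(T)$: the vertices of the form $ui$ are the v such that
   [v = rcons u (last 0 v)]; then $i$ is [last 0 v]. *)
Definition nsons (T : tree) (u : vertex) : nat :=
  \max_(v <- T | v == rcons u (last 0%N v)) last 0%N v.

Definition subtree (T : tree) (i : nat) : tree :=
  [fset behead u | u in T & u == i :: behead u]%fset.

Definition graft (i : nat) (T : tree) : tree := [fset i :: u | u in T]%fset.

Lemma mem_subtree T i u : (u \in subtree T i) = (i :: u \in T).
Proof.
apply/imfsetP/idP => [[v /= /andP[vT /eqP e] ->]|iu]; first by rewrite -e.
by exists (i :: u) => //=; rewrite !inE iu eqxx.
Qed.

Lemma mem_graft i T u :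
  (u \in graft i T) = (u == i :: behead u) && (behead u \in T).
Proof.
apply/imfsetP/andP => [[v /= vT ->]|[/eqP-> /= uT]]; first by rewrite eqxx.
by exists (behead u).
Qed.

Lemma leq_nsons T u i : is_tree T -> (0 < i)%N ->
  (i <= nsons T u)%N = (rcons u i \in T).
Proof.
move=> [_ _ _ sibT] i0; apply/idP/idP => [|uiT]; last first.
  rewrite -[X in (X <= _)%N](last_rcons 0%N u i).
  by apply: leq_bigmax_seq; rewrite // last_rcons.
apply: contraTT => uiT; rewrite -ltnNge -[i]prednK// ltnS.
apply/bigmax_leqP_seq => v vT /eqP e; rewrite leqNgt prednK//.
apply: contra uiT => lt; have [<-|ne] := eqVneq (last 0%N v) i; first by rewrite -e.
by apply: (sibT u i (last 0%N v)); rewrite -?e// i0 ltn_neqAle eq_sym ne.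
Qed.

Lemma subtree_is_tree T i : is_tree T -> (0 < i <= nsons T [::])%N ->
  is_tree (subtree T i).
Proof.
move=> tT /andP[i0]; rewrite leq_nsons//= => iT; case: tT => posT _ preT sibT.
split=> [u|||]; rewrite ?mem_subtree//.
- by move=> /posT; rewrite inE negb_or => /andP[].
- by move=> u j; rewrite !mem_subtree -rcons_cons; exact: preT.
- by move=> u j k jk; rewrite !mem_subtree -!rcons_cons; exact: sibT.
Qed.

Lemma card_subtree T i : is_tree T -> (#|` subtree T i| < #|` T|)%N.
Proof.
move=> [_ T0 _ _].
have -> : #|` subtree T i|%fset = #|` graft i (subtree T i)|%fset.
  by rewrite [RHS]card_imfset// => u v [].
apply: fproper_ltn_card; rewrite fproperE; apply/andP; split.
  by apply/fsubsetP => u; rewrite mem_graft mem_subtree => /andP[/eqP {2}->].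
by apply/negP => /fsubsetP/(_ _ T0); rewrite mem_graft.
Qed.

(* $T$ without its leaves $E(T)$. *)
Definition internal (T : tree) : tree := [fset u in T | nsons T u != 0]%fset.

Section TreeTnu.
Context {R : realType} (alpha : R).

(* [absz] only casts from int to nat: see [qidx_ceil], [mval_ceil]. *)
Definition qidx (l nu i : nat) : nat :=
  absz (nu%:Z + Num.ceil (i%:R - (1 + alpha) * l.+1%:R * (i%:R - 1))).

Definition mval (l nu : nat) : nat :=
  absz (Num.ceil (nu%:R / ((1 + alpha) * l%:R + alpha))).

(* The recursions for $T_l^\nu$ and $k(l,\nu)$ stop after at most
   $\lceil \nu/\alpha \rceil$ steps; [treeT_eq] and [kval_eq] below are the
   recursive equations. *)
Definition depth (nu : nat) : nat := absz (Num.ceil (nu%:R / alpha)).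

Fixpoint treeT_rec (fuel l nu : nat) : tree :=
  if fuel is fuel'.+1 then
    (root_tree `|` \bigcup_(i <- index_iota 1 (mval l nu))
       graft i (treeT_rec fuel' l.+1 (qidx l nu i)))%fset
  else root_tree.

Definition treeT (l nu : nat) : tree := treeT_rec (depth nu) l nu.

Fixpoint kval_rec (beta fuel l nu : nat) : nat :=
  if fuel is fuel'.+1 then
    maxn (beta * mval l nu)
      (\max_(1 <= i < mval l nu) i * kval_rec beta fuel' l.+1 (qidx l nu i))
  else beta * mval l nu.

Definition kval (beta l nu : nat) : nat := kval_rec beta (depth nu) l nu.

Context (alpha_gt0 : 0 < alpha).

Let denom_gt0 l : 0 < (1 + alpha) * l%:R + alpha.
Proof. by rewrite ltr_wpDl// mulr_ge0 ?ler0n// addr_ge0 ?ltW. Qed.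

Lemma mval_ceil l nu :
  (mval l nu)%:Z = Num.ceil (nu%:R / ((1 + alpha) * l%:R + alpha)).
Proof.
rewrite /mval gez0_abs// ceil_ge0 (lt_le_trans (ltrN10 R))//.
by rewrite divr_ge0 ?ler0n// ltW.
Qed.

Lemma lt_mval l nu i :
  (i < mval l nu)%N = (i%:R * ((1 + alpha) * l%:R + alpha) < nu%:R).
Proof. by rewrite -ltz_nat mval_ceil ceil_gt_int ltr_pdivlMr. Qed.

Lemma qidx_ceil l nu i : (0 < i < mval l nu)%N ->
  (0 < qidx l nu i)%N /\ (qidx l nu i)%:Z =
    nu%:Z + Num.ceil (i%:R - (1 + alpha) * l.+1%:R * (i%:R - 1)).
Proof.
move=> /andP[i0]; rewrite lt_mval => im.
have h : 0 < nu%:Z + Num.ceil (i%:R - (1 + alpha) * l.+1%:R * (i%:R - 1)).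
  rewrite -ltrBlDl sub0r ceil_gt_int mulrNz -natr1.
  rewrite -pmulrn; have := mulr_ge0 (ltW alpha_gt0) (ler0n R l).
  by have := ler0n R l; have := alpha_gt0; move: im; lra.
by rewrite -ltz_nat {1 2}/qidx gtz0_abs.
Qed.

Lemma qidx_le l nu i : (0 < i < mval l nu)%N -> (qidx l nu i <= nu.+1)%N.
Proof.
move=> il; have [_ e] := qidx_ceil il.
rewrite -lez_nat e -[nu.+1]addn1 PoszD lerD2l ceil_le_int.
case/andP: il => i0 _.
have i1 : 1 <= i%:R :> R by rewrite ler1n.
have := mulr_ge0 (ltW (denom_gt0 l)) (_ : 0 <= i%:R - 1 :> R).
by rewrite subr_ge0 => /(_ i1); rewrite -natr1; lra.
Qed.

Let enough (fuel l nu : nat) : bool :=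
  nu%:R <= l%:R + alpha * (l + fuel).+1%:R.

Let enough0 l nu : enough 0 l nu -> (mval l nu <= 1)%N.
Proof.
rewrite /enough addn0 -natr1 leqNgt lt_mval -leNgt => h.
by rewrite mul1r (le_trans h)//; lra.
Qed.

Let enoughS fuel l nu i : enough fuel.+1 l nu -> (0 < i < mval l nu)%N ->
  enough fuel l.+1 (qidx l nu i).
Proof.
rewrite /enough addSnnS => h /qidx_le.
rewrite -(ler_nat R) => /le_trans; apply.
by rewrite -!(natr1 nu) -!(natr1 l) addrAC lerD2r.
Qed.

Let enough_depth l nu : enough (depth nu) l nu.
Proof.
have : nu%:R <= alpha * (depth nu)%:R.
  rewrite mulrC -ler_pdivrMr// /depth natr_absz ger0_norm ?ceil_ge//.
  by rewrite ceil_ge0 (lt_le_trans (ltrN10 R))// divr_ge0 ?ler0n// ltW.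
rewrite /enough -addSn natrD mulrDr => /le_trans; apply.
by rewrite addrA lerDr addr_ge0 ?ler0n// mulr_ge0 ?ler0n// ltW.
Qed.

Let treeT_rec_enough m n l nu : enough m l nu -> enough n l nu ->
  treeT_rec m l nu = treeT_rec n l nu.
Proof.
elim: m n l nu => [|m ih] [|n] l nu //= hm hn.
- by rewrite big_geq ?fsetU0// enough0.
- by rewrite big_geq ?fsetU0// enough0.
- congr (_ `|` _)%fset; apply: eq_big_seq => i; rewrite mem_index_iota => im.
  by congr graft; apply: ih; exact: enoughS im.
Qed.

Lemma treeT_eq l nu : treeT l nu =
  (root_tree `|` \bigcup_(i <- index_iota 1 (mval l nu))
     graft i (treeT l.+1 (qidx l nu i)))%fset.
Proof.
have h := enough_depth l nu.
have h1 : enough (depth nu).+1 l nu.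
  apply: (le_trans h); rewrite lerD2l; apply: ler_wpM2l; first exact: ltW.
  by rewrite ler_nat addnS.
rewrite {1}/treeT (treeT_rec_enough h h1) /=.
congr (_ `|` _)%fset; apply: eq_big_seq => i; rewrite mem_index_iota => im.
by congr graft; apply: treeT_rec_enough => //; exact: enoughS im.
Qed.

Lemma treeT_is_tree l nu : is_tree (treeT l nu).
Proof.
rewrite /treeT; move: (depth nu) => n; elim: n l nu => [|n ih] l nu /=.
  split=> [u|||].
  - by rewrite inE => /eqP->.
  - by rewrite inE.
  - by case=> [|a u] j; rewrite inE.
  - by case=> [|a u] i j _; rewrite inE.
set F := fun i => treeT_rec n l.+1 (qidx l nu i).
have tF i : is_tree (F i) by exact: ih.
rewrite -/F; set U := (_ `|` _)%fset.
have U0 : [::] \in U by rewrite !inE eqxx.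
have UE i u : (i :: u \in U) = (0 < i < mval l nu)%N && (u \in F i).
  rewrite !inE /=; apply/bigfcupP/andP => [[j]|[im uF]].
    rewrite andbT mem_index_iota mem_graft /= => jm /andP[/eqP[->]] uF.
    by split.
  by exists i; rewrite ?mem_index_iota ?im// mem_graft eqxx.
split=> //.
- case=> [//|i u]; rewrite UE inE negb_or => /andP[/andP[i0 _] uF].
  by case: (tF i) => posF _ _ _; rewrite neq_ltn i0 posF.
- case=> [//|i u] j; rewrite rcons_cons !UE => /andP[-> uF].
  by case: (tF i) => _ _ preF _; exact: preF uF.
- case=> [|a u] i j ij; rewrite ?rcons_cons !UE.
    move=> /andP[/andP[j0 jm] _]; case: (tF i) => _ -> _ _.
    by case/andP: ij => -> /ltn_trans ->.
  by move=> /andP[-> uF]; case: (tF a) => _ _ _ sibF; exact: sibF uF.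
Qed.

Let kval_rec_enough beta m n l nu : enough m l nu -> enough n l nu ->
  kval_rec beta m l nu = kval_rec beta n l nu.
Proof.
elim: m n l nu => [|m ih] [|n] l nu //= hm hn.
- by rewrite big_geq ?maxn0// enough0.
- by rewrite big_geq ?maxn0// enough0.
- congr maxn; apply: eq_big_nat => i im.
  by congr muln; apply: ih; exact: enoughS im.
Qed.

Lemma kval_eq beta l nu : kval beta l nu =
  maxn (beta * mval l nu)
    (\max_(1 <= i < mval l nu) i * kval beta l.+1 (qidx l nu i)).
Proof.
have h := enough_depth l nu.
have h1 : enough (depth nu).+1 l nu.
  apply: (le_trans h); rewrite lerD2l; apply: ler_wpM2l; first exact: ltW.
  by rewrite ler_nat addnS.
rewrite {1}/kval (kval_rec_enough _ h h1) /=.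
congr maxn; apply: eq_big_nat => i im.
by congr muln; apply: kval_rec_enough => //; exact: enoughS im.
Qed.

End TreeTnu.

Fixpoint tensor (FF : {fset tree}) (m : nat) : {fset tree} :=
  if m is m'.+1 then
    [fset (A `|` graft m'.+1 S)%fset | A in tensor FF m', S in FF]%fset
  else [fset root_tree]%fset.

(* The subtrees $T_i'$ have fewer vertices than $T$: the recursive equation is
   [treeF_eq]. *)
Fixpoint treeF_rec (fuel : nat) (T : tree) : {fset tree} :=
  if fuel is fuel'.+1 then
    ([fset root_tree] `|` \bigcup_(i <- index_iota 1 (nsons T [::]).+1)
       tensor (treeF_rec fuel' (subtree T i)) i)%fset
  else [fset root_tree]%fset.

Definition treeF (T : tree) : {fset tree} := treeF_rec #|` T|%fset T.

Lemma treeF_rec_enough m n T : is_tree T ->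
  (#|` T| <= m)%N -> (#|` T| <= n)%N -> treeF_rec m T = treeF_rec n T.
Proof.
elim: m n T => [|m ih] [|n] T tT //= hm hn.
- by case: (tT) hm => _ T0 _ _; rewrite leqn0 cardfs_eq0 => /eqP e; rewrite e inE in T0.
- by case: (tT) hn => _ T0 _ _; rewrite leqn0 cardfs_eq0 => /eqP e; rewrite e inE in T0.
congr (_ `|` _)%fset; apply: eq_big_seq => i; rewrite mem_index_iota ltnS => il.
have lt := card_subtree i tT.
congr tensor; apply: ih; first exact: subtree_is_tree.
- exact: leq_trans lt hm.
- exact: leq_trans lt hn.
Qed.

Lemma treeF_eq T : is_tree T -> treeF T =
  ([fset root_tree] `|` \bigcup_(i <- index_iota 1 (nsons T [::]).+1)
     tensor (treeF (subtree T i)) i)%fset.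
Proof.
move=> tT; rewrite {1}/treeF (@treeF_rec_enough _ #|` T|.+1)//=.
congr (_ `|` _)%fset; apply: eq_big_seq => i; rewrite mem_index_iota ltnS => il.
congr tensor; apply: treeF_rec_enough => //; first exact: subtree_is_tree.
exact: ltnW (card_subtree i tT).
Qed.

(* A strictly increasing sequence in $\{0,\dots,n-1\}$ has length at most n. *)
Notation labelling n A := {ffun internal A -> n.-bseq 'I_n}.

Definition is_labelling (n : nat) (A : tree) (kappa : labelling n A) : bool :=
  [forall u, (size (kappa u) == nsons A (val u))
             && sorted ltn [seq val k | k <- kappa u]].

Definition label (n : nat) (A : tree) (kappa : labelling n A) (u : vertex) :
    seq nat :=
  if insub u is Some v then [seq val k | k <- kappa v] else [::].

(* Independence and uniformity of the $\kappa(u)$ amount to the uniform law on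
   the product set [is_labelling]. *)
Definition expect {R : realType} {V : lmodType R} (n : nat) (A : tree)
    (X : (vertex -> seq nat) -> V) : V :=
  (#|[set kappa : labelling n A | is_labelling kappa]|%:R)^-1 *:
    \sum_(kappa : labelling n A | is_labelling kappa) X (label kappa).

Section Operators.
Context {V : zmodType} (n : nat) (Q : nat -> V -> V).

(* $A_i \cdots A_1$ *)
Fixpoint opprod (i : nat) (op : nat -> V -> V) : V -> V :=
  if i is i'.+1 then op i'.+1 \o opprod i' op else id.

(* $\kappa_j$ for $j \geq 1$, and $\kappa_j'$, where $k = \kappa(\emptyset)$ *)
Definition kap (k : seq nat) (j : nat) : nat := nth 0%N k j.-1.
Definition kap' (k : seq nat) (j : nat) : nat :=
  if j is 0 then 0%N else (kap k j).+1.

(* As for [treeF], the recursive equation is [Gamma_eq]. The differences of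
   naturals do not truncate when [k] is a label. *)
Fixpoint Gamma_rec (fuel l : nat) (A : tree) (kappa : vertex -> seq nat) :
    V -> V :=
  if fuel is fuel'.+1 then
    let i := nsons A [::] in
    let k := kappa [::] in
    if i == 0%N then fun f => iter n (Q l.+1) f - Q l f
    else iter (n - kap' k i) (Q l.+1) \o
         opprod i (fun j =>
           Gamma_rec fuel' l.+1 (subtree A j) (fun v => kappa (j :: v)) \o
           iter (kap k j - kap' k j.-1) (Q l.+1))
  else id.

Definition Gamma (l : nat) (A : tree) (kappa : vertex -> seq nat) : V -> V :=
  Gamma_rec #|` A|%fset l A kappa.

Lemma eq_opprod i op op' : (forall j, (0 < j <= i)%N -> op j =1 op' j) ->
  opprod i op =1 opprod i op'.
Proof.
elim: i => [//|i ih] h f /=; rewrite ih; first by apply: h; rewrite leqnn.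
by move=> j /andP[j0 ji]; apply: h; rewrite j0 ltnW.
Qed.

Lemma Gamma_rec_enough p q l A kappa : is_tree A ->
  (#|` A| <= p)%N -> (#|` A| <= q)%N ->
  Gamma_rec p l A kappa =1 Gamma_rec q l A kappa.
Proof.
elim: p q l A kappa => [|p ih] [|q] l A kappa tA //= hp hq f.
- by case: (tA) hp => _ A0 _ _; rewrite leqn0 cardfs_eq0 => /eqP e; rewrite e inE in A0.
- by case: (tA) hq => _ A0 _ _; rewrite leqn0 cardfs_eq0 => /eqP e; rewrite e inE in A0.
case: ifP => // _; congr iter; apply: eq_opprod => j jA g.
have lt := card_subtree j tA.
apply: ih; first exact: subtree_is_tree.
- exact: leq_trans lt hp.
- exact: leq_trans lt hq.
Qed.

Lemma Gamma_eq l A kappa : is_tree A ->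
  let i := nsons A [::] in
  let k := kappa [::] in
  Gamma l A kappa =1
  if i == 0%N then fun f => iter n (Q l.+1) f - Q l f
  else iter (n - kap' k i) (Q l.+1) \o
       opprod i (fun j =>
         Gamma l.+1 (subtree A j) (fun v => kappa (j :: v)) \o
         iter (kap k j - kap' k j.-1) (Q l.+1)).
Proof.
move=> tA i k f; rewrite {1}/Gamma (@Gamma_rec_enough _ #|` A|.+1)//=.
rewrite -/i -/k; case: ifP => // _; congr iter; apply: eq_opprod => j jA g.
apply: Gamma_rec_enough => //; first exact: subtree_is_tree.
exact: ltnW (card_subtree j tA).
Qed.

End Operators.

Definition coef (n : nat) (A : tree) : nat := \prod_(u <- A) 'C(n, nsons A u).

Definition Qhat {R : realType} {V : lmodType R} (n : nat) (Q : nat -> V -> V)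
    (T : tree) (f : V) : V :=
  Q 0%N f + \sum_(A <- treeF T)
    (coef n A)%:R *: expect n A (fun kappa => Gamma n Q 0 A kappa f).

Section Hypotheses.
Context {R : realType} {d : nat}.
Implicit Types (P : R -> {linear Cb R d -> Cb R d})
  (Q : nat -> nat -> {linear Cb R d -> Cb R d}).

Definition step (T : R) (n l : nat) : R := T / n%:R ^+ l.

(* Only the $P_t$ with $t \geq 0$ are constrained. *)
Definition semigroup P : Prop :=
  P 0 =1 id /\
  forall s t, 0 <= s -> 0 <= t -> P (t + s) =1 P t \o P s.

(* [Q n l] is the operator $Q_l$ for the given n. *)
Definition H1 (alpha : R) (beta : nat) (T : R) P Q : Prop :=
  forall l k : nat, exists2 C : R, 0 < C &
    forall n : nat, (0 < n)%N -> forall f : Cb R d,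
      cbnorm k (P (step T n l) f - Q n l f)
        <= C * cbnorm (k + beta) f * step T n l `^ (1 + alpha).

(* The supremum over t is taken in the extended reals: its finiteness is part
   of the hypothesis. *)
Definition H2 (T : R) P Q : Prop :=
  forall l m : nat, exists2 C : R, 0 < C &
    forall n : nat, (0 < n)%N -> forall f : Cb R d,
      ((\big[Num.max/0]_(k < (n ^ l).+1) cbnorm m (iter k (Q n l) f))%:E
       + ereal_sup [set (cbnorm m (P t f))%:E | t in [set t : R | (0 <= t <= T)%R]]%classic
         <= (C * cbnorm m f)%:E)%E.

End Hypotheses.

(* Main.v *)
From HB Require Import structures.
Require Import Defs.
From mathcomp Require Import all_boot all_order all_algebra finmap zify ring lra.
From mathcomp Require Import all_classical all_reals all_analysis.
Set Implicit Arguments.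
Unset Strict Implicit.
Unset Printing Implicit Defensive.
Import Order.TTheory GRing.Theory Num.Theory.
Local Open Scope ring_scope.

(** Write p, q for the exact and the approximate operator of step
    h_(l+1), D for p - q, and e for (1 + alpha) * l + alpha. Since h_l is
    n * h_(l+1), the operator P at time h_l is the n-th power of p = q + D.
    Expanding this power but stopping after m letters D
    ([iter_perturbation]) gives
    - for each i < m, the sum of all words of length n with exactly i
      letters D, the other letters being q;
    - a remainder whose words contain m letters D, with letters p to the left
      of all of them and letters q elsewhere.
    Consistency bounds D by n^-(e+1), at the price of beta derivatives, while
    there are at most n^i words with i letters D; so i letters contribute
    n^(- i * e). The number m(l, nu) is the least m for which the remainder is
    of order n^-nu.

    In the words with i letters, D is not computable, but it can be replaced by
    an approximation B_i of the same kind, one level deeper, with an error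
    n^-q_i. Replacing the letters one at a time costs
    n^(i - (e+1) * (i-1) - q_i), which is at most n^-nu by the choice of q_i
    ([son_order]). Since q_i is also at least e + 1, the operators B_i obey the
    same bounds as D. At each level the order grows by at most one and e by
    1 + alpha, so the induction ends: after finitely many levels m(l, nu) <= 1
    and nothing is left to replace ([converges_all]).

    It remains to see that the sum over the labelled trees of F(T) computes
    exactly this recursion ([correction_eq]). The coefficient c(A) counts the
    labellings of A, so c(A) times the expectation of Gamma is the plain sum of
    Gamma over labellings ([coef_expect]). A labelling of A is a labelling of
    its root, which says where the i letters of a word of length n stand,
    together with one labelling of each subtree, chosen independently. As all
    operators are additive, summing over the labels of the subtrees
    ([fsum_opprod]) and over the subtrees themselves ([sum_tensor]) can be done
    factor by factor inside the product, which turns each factor into B_i; and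
    summing over the labels of the root gives the sum of words
    ([sum_incs_words]). *)

(** * Additive operators *)

Section Additive.
Context {V : zmodType}.
Local Notation additive := (@zmod_morphism V V).
Implicit Types f : V -> V.

Lemma zmod_morph0 f : additive f -> f 0 = 0.
Proof. by move=> h; rewrite -[X in f X](subrr 0) h subrr. Qed.

Lemma zmod_morph_sum f I (r : seq I) (p : pred I) F : additive f ->
  f (\sum_(i <- r | p i) F i) = \sum_(i <- r | p i) f (F i).
Proof.
move=> h; pose fa : {additive V -> V} :=
  HB.pack f (GRing.isZmodMorphism.Build V V f h).
exact: (raddf_sum fa).
Qed.

Lemma zmod_morph_comp f g : additive f -> additive g ->
  additive (f \o g).
Proof. by move=> hf hg x y /=; rewrite hg hf. Qed.

Lemma zmod_morph_iter k f : additive f -> additive (iter k f).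
Proof. by move=> h; elim: k => [//|k ih] x y /=; rewrite ih h. Qed.

Lemma zmod_morph_bigsum I (r : seq I) (F : I -> V -> V) :
  (forall i, additive (F i)) ->
  additive (fun x => \sum_(i <- r) F i x).
Proof. by move=> h x y; rewrite -sumrB; apply: eq_bigr => i _; exact: h. Qed.

End Additive.

(** * Words in two operators *)

Section Words.
Context {V : zmodType}.
Local Notation additive := (@zmod_morphism V V).
Implicit Types p q B D : V -> V.

(** The words of length [t] in the letters [q] and [B] that have [i] letters [B],
    the leftmost letter being one of them, are applied to [f] and added up. For
    [i = 0] this leaves the empty word only. *)
Fixpoint words q B (f : V) (i t : nat) : V :=
  if i is i'.+1 then \sum_(s < t) B (iter (t - s.+1) q (words q B f i' s))
  else if t == 0%N then f else 0.

Lemma wordsS q B f i t :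
  words q B f i.+1 t = \sum_(s < t) B (iter (t - s.+1) q (words q B f i s)).
Proof. by []. Qed.

Lemma iter_sub p q N (x : V) : additive p -> additive q ->
  iter N p x - iter N q x =
  \sum_(s < N) iter (N - s.+1) p (p (iter s q x) - q (iter s q x)).
Proof.
move=> hp hq; elim: N => [|N ih]; first by rewrite big_ord0 subrr.
rewrite big_ord_recr /= subnn /= -[LHS](subrKA (p (iter N q x))) addrC -hp ih.
rewrite zmod_morph_sum // addrC; congr (_ + _).
by apply: eq_bigr => s _; rewrite subSn //.
Qed.

(** Substitution of [t + s + 1] for the new outer index: the position of the
    next letter, given that of the last one and the gap between them. *)
Lemma exchange_triangle (F : nat -> nat -> V) n :
  \sum_(t < n.+1) \sum_(s < n - t) F t s =
  \sum_(t' < n.+1) \sum_(t < t') F t (t' - t.+1)%N.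
Proof.
transitivity (\sum_(0 <= t < n) \sum_(t.+1 <= t' < n.+1) F t (t' - t.+1)%N).
  rewrite big_ord_recr /= subnn big_ord0 addr0 big_mkord; apply: eq_bigr => t _.
  rewrite -(big_mkord predT (F t)) -(add0n t.+1) big_addn subSS.
  by apply: eq_bigr => s _; rewrite addnK.
transitivity (\sum_(0 <= t < n.+1) \sum_(0 <= t' < n.+1 | (t < t')%N) F t (t' - t.+1)%N).
  rewrite [RHS]big_nat_recr //= [X in _ = _ + X]big_nat_cond.
  rewrite [X in _ = _ + X]big_pred0 ?addr0; last by move=> s; lia.
  by apply: eq_bigr => t _; rewrite (@big_nat_widenl _ _ _ _ 0%N).
rewrite (exchange_big_dep_nat predT) //= big_mkord; apply: eq_bigr => t' _.
rewrite -(big_mkord predT (fun t => F t (t' - t.+1)%N)).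
by rewrite [RHS](@big_nat_widen _ _ _ _ _ n.+1) // ltnW.
Qed.

Lemma sum_words0 p q B n f : additive p ->
  \sum_(t < n.+1) iter (n - t) p (words q B f 0 t) = iter n p f.
Proof.
move=> hp; rewrite big_ord_recl subn0 big1 ?addr0 //= => t _.
exact: zmod_morph0 (zmod_morph_iter _ hp).
Qed.

(** The block of letters [p] at the left of each word of the remainder is
    rewritten by [iter_sub]: either all its letters become [q], or a new letter
    [D] appears, and only letters [p] stand to the left of it. *)
Lemma iter_perturbation p q n m (f : V) : additive p -> additive q ->
  let D := fun x => p x - q x in
  iter n p f =
  \sum_(0 <= i < m) \sum_(t < n.+1) iter (n - t) q (words q D f i t) +
  \sum_(t < n.+1) iter (n - t) p (words q D f m t).
Proof.
move=> hp hq D.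
elim: m => [|m ->]; first by rewrite big_geq // add0r sum_words0.
rewrite big_nat_recr //= -addrA; congr (_ + _).
apply/eqP; rewrite [X in _ == X]addrC -subr_eq -sumrB; apply/eqP.
transitivity (\sum_(t < n.+1) \sum_(s < n - t)
    iter (n - t - s.+1) p (D (iter s q (words q D f m t)))).
  by apply: eq_bigr => t _; exact: iter_sub.
rewrite (exchange_triangle
  (fun t s => iter (n - t - s.+1) p (D (iter s q (words q D f m t))))).
apply: eq_bigr => t' _.
rewrite (zmod_morph_sum _ _ _ (zmod_morph_iter _ hp)); apply: eq_bigr => t _.
by congr (iter _ p _); have := ltn_ord t; have := ltn_ord t'; lia.
Qed.

End Words.

(** * Positions of the letters *)

Section Increasing.

(** The increasing sequences are enumerated by appending their last entry, so
    that sums over them follow the recursion of [words]. *)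
Fixpoint incs (n i : nat) : seq (seq nat) :=
  if i is i'.+1 then
    [seq rcons k x | k <- incs n i', x <- iota (kap' k i') (n - kap' k i')]
  else [:: [::]].

Lemma incsS n i : incs n i.+1 =
  [seq rcons k x | k <- incs n i, x <- iota (kap' k i) (n - kap' k i)].
Proof. by []. Qed.

Lemma kap'_rcons k x : kap' (rcons k x) (size k).+1 = x.+1.
Proof. by rewrite /kap' /kap /= nth_rcons ltnn eqxx. Qed.

Lemma kap_rcons_lt k x j : (0 < j <= size k)%N -> kap (rcons k x) j = kap k j.
Proof. by case: j => // j /= jk; rewrite /kap /= nth_rcons jk. Qed.

Lemma kap'_rcons_lt k x j : (j <= size k)%N -> kap' (rcons k x) j = kap' k j.
Proof. by case: j => // j jk; rewrite /kap' kap_rcons_lt. Qed.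

Lemma sorted_rcons_kap' k x :
  sorted ltn (rcons k x) = (sorted ltn k && (kap' k (size k) <= x)%N).
Proof.
case: k => [//|a p]; rewrite /= rcons_path; congr (_ && _).
by rewrite /kap (last_nth 0%N).
Qed.

Lemma mem_incs n i k :
  (k \in incs n i) = [&& size k == i, sorted ltn k & all (gtn n) k].
Proof.
elim: i k => [|i ih] k; first by rewrite inE; case: k.
rewrite incsS; apply/allpairsPdep/idP => [[k' [x []]]|].
  rewrite ih => /and3P[/eqP <- sk ak]; rewrite mem_iota => hx ->.
  rewrite size_rcons eqxx sorted_rcons_kap' sk all_rcons ak andbT /=.
  by move: (kap' _ _) (x : nat) hx => c y; lia.
case/lastP: k => [//|k x]; rewrite size_rcons eqSS sorted_rcons_kap' all_rcons /=.
move=> /and3P[/eqP si /andP[sk]]; rewrite si => hx /andP[xn ak].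
by exists k, x; rewrite ih si eqxx sk ak mem_iota; split => //; lia.
Qed.

Lemma incs_uniq n i : uniq (incs n i).
Proof.
elim: i => [//|i ih]; rewrite incsS; apply: allpairs_uniq_dep => // [k _|]; first exact: iota_uniq.
by move=> [k x] [k' x'] _ _ /= /eqP; rewrite eqseq_rcons => /andP[/eqP-> /eqP->].
Qed.

Lemma size_incs n i k : k \in incs n i -> size k = i.
Proof. by rewrite mem_incs => /and3P[/eqP]. Qed.

Context {V : zmodType}.
Local Notation additive := (@zmod_morphism V V).

(** The entries of [k] are the positions of the letters [B], counted from the
    right. The family [Psi] stands for what is applied to the left of the last
    [B]; it is arbitrary because the induction on [i] absorbs into it the
    last letter [B] and the letters [q] applied just before it. *)
Lemma sum_incs_words n i (q B : V -> V) (Psi : nat -> V -> V) f :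
  additive q -> additive B -> (forall t, additive (Psi t)) ->
  \sum_(k <- incs n i) Psi (kap' k i)
    (opprod i (fun j => B \o iter (kap k j - kap' k j.-1) q) f) =
  \sum_(t < n.+1) Psi t (words q B f i t).
Proof.
move=> hq hB; elim: i Psi => [|i ih] Psi hP.
  rewrite big_seq1 big_ord_recl big1 ?addr0 //= => t _; exact: zmod_morph0.
pose Phi t v := \sum_(s < n - t) Psi (t + s).+1 (B (iter s q v)).
rewrite incsS big_allpairs_dep.
transitivity (\sum_(k <- incs n i) Phi (kap' k i)
    (opprod i (fun j => B \o iter (kap k j - kap' k j.-1) q) f)).
  rewrite big_seq [RHS]big_seq; apply: eq_bigr => k /size_incs sk.
  rewrite -[X in iota X]addn0 iotaDl big_map -[n in iota 0 n]subn0 -/(index_iota _ _).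
  have kS x : kap' (rcons k x) i.+1 = x.+1 by rewrite -sk kap'_rcons.
  rewrite big_mkord; apply: eq_bigr => s _.
  rewrite kS /= kap'_rcons_lt ?sk //; congr (Psi _ _).
  have /succn_inj -> := kS (kap' k i + s)%N.
  rewrite addKn; congr (B (iter _ q _)); apply: eq_opprod => j /andP[j0 ji] v /=.
  by rewrite kap_rcons_lt ?kap'_rcons_lt ?sk ?j0 // (leq_trans (leq_pred _)).
rewrite ih; last first.
  move=> t; apply: zmod_morph_bigsum => s.
  exact: zmod_morph_comp (hP _) (zmod_morph_comp hB (zmod_morph_iter _ hq)).
rewrite (exchange_triangle (fun t s => Psi (t + s).+1 (B (iter s q (words q B f i t))))).
apply: eq_bigr => t _; rewrite /= zmod_morph_sum //; apply: eq_bigr => s _.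
by congr (Psi _ _); have := ltn_ord s; lia.
Qed.

End Increasing.

(** * Sums over labellings *)

Section Labels.
Local Open Scope classical_set_scope.
Implicit Types (n i : nat) (c : vertex -> nat) (A B : {fset vertex}).

(** Labels are functions on all vertices, empty outside [B]: then labels
    do not depend on a type attached to [B], and two of them with disjoint
    domains are merged by pointwise concatenation, as in [fsum_labU]. *)
Definition lab n c B : set (vertex -> seq nat) :=
  [set kappa | forall u,
     if u \in B then (kappa u \in incs n (c u) : Prop) else kappa u = [::]].

Lemma incs_bseq n i k : k \in incs n i ->
  exists b : n.-bseq 'I_n, [seq val x | x <- b] = k.
Proof.
rewrite mem_incs => /and3P[_ sk ak].
have kn : {subset k <= iota 0 n}.
  by move=> x /(allP ak) /= xn; rewrite mem_iota add0n.
have sz : (size k <= n)%N.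
  rewrite -[n](size_iota 0); apply: uniq_leq_size kn.
  exact: (sorted_uniq ltn_trans ltnn).
have e : [seq val x | x <- pmap (@insub _ (fun x => x < n)%N 'I_n) k] = k.
  by rewrite pmap_filter ?(eq_filter (a2 := gtn n)) ?(all_filterP ak) // => x;
     rewrite ?isSome_insub //; exact: insubK.
rewrite -e size_map in sz; by exists (Bseq sz).
Qed.

Definition ffun_label n B (kappa : {ffun B -> n.-bseq 'I_n}) (u : vertex) : seq nat :=
  if insub u is Some v then [seq val k | k <- kappa v] else [::].

Definition ffun_labelling n c B : set {ffun B -> n.-bseq 'I_n} :=
  [set` [pred kappa : {ffun B -> n.-bseq 'I_n} | [forall u,
     (size (kappa u) == c (val u)) && sorted ltn [seq val k | k <- kappa u]]]].

Lemma ffun_label_bij n c B : set_bij (@ffun_labelling n c B) (lab n c B) (@ffun_label n B).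
Proof.
split.
- move=> kappa /forallP h u; rewrite /ffun_label; case: insubP => [v -> <-|/negbTE-> //].
  rewrite mem_incs size_map; have /andP[-> ->] := h v; rewrite !andTb.
  by apply/allP => _ /mapP[x _ ->] /=.
- move=> kappa kappa' _ _ e; apply/ffunP => v.
  apply/val_inj/(inj_map val_inj); have := congr1 (fun f => f (val v)) e.
  by rewrite /ffun_label valK.
- move=> kappa h.
  have hb v : exists b : n.-bseq 'I_n, v \in B -> [seq val x | x <- b] = kappa v.
    have := h v; case: ifP => [_ /incs_bseq[b eb]|_ _]; first by exists b.
    by exists [bseq].
  have [b hb'] := choice hb; exists [ffun v => b (val v)].
    apply/forallP => v; rewrite ffunE -(size_map val) (hb' _ (valP v)).
    by have := h (val v); rewrite (valP v) mem_incs => /and3P[-> ->].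
  apply/funext => u; rewrite /ffun_label; case: insubP => [v uB <-|/negbTE uB].
    by rewrite ffunE (hb' _ (valP v)).
  by have := h u; rewrite uB.
Qed.

Lemma lab_finite n c B : finite_set (lab n c B).
Proof.
have [_ _ sub] := ffun_label_bij n c B; apply: sub_finite_set sub _.
exact/finite_image/finite_finset.
Qed.

Context {V : zmodType}.
Implicit Types X : (vertex -> seq nat) -> V.

Lemma fsum_labU n c A B X : [disjoint A & B]%fset ->
  \sum_(kappa \in lab n c (A `|` B)%fset) X kappa =
  \sum_(kappa \in lab n c A) \sum_(kappa' \in lab n c B)
     X (fun u => kappa u ++ kappa' u).
Proof.
move=> /fdisjointP dAB; rewrite pair_fsbig; [|exact: lab_finite|exact: lab_finite].
apply: (reindex_fsbig (fun p u => p.1 u ++ p.2 u)); split.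
- move=> [k k'] [/= hk hk'] u; rewrite inE; move: (hk u) (hk' u).
  case: ifPn => [/dAB/negbTE -> ku ->|uA ->]; first by rewrite cats0.
  by case: ifP.
- move=> [k k'] [l l'] /set_mem[/= hk hk'] /set_mem[/= hl hl'] e; congr (_, _); apply/funext => u;
  have := congr1 (fun f => f u) e; move: (hk u) (hk' u) (hl u) (hl' u) => /=.
    by case: ifPn => [/dAB/negbTE -> _ -> _ ->|_ -> _ -> //]; rewrite !cats0.
  by case: ifPn => [/dAB/negbTE -> _ -> _ ->|_ -> _ -> //].
- move=> k hk; exists (fun u => if u \in A then k u else [::],
                      fun u => if u \in B then k u else [::]); last first.
    apply/funext => u /=; have := hk u; rewrite inE.
    case: (boolP (u \in A)) => [/dAB/negbTE ->|_] /=; first by rewrite cats0.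
    by case: ifP => // _ ->.
  by split=> u /=; have := hk u; rewrite inE;
    case: (u \in A); case: (u \in B).
Qed.

Lemma fsum_lab0 n c X :
  \sum_(kappa \in lab n c fset0) X kappa = X (fun=> [::]).
Proof.
suff -> : lab n c fset0 = [set fun=> [::]] by exact: fsbig_set1.
apply/seteqP; split => [k hk|_ -> u].
  by apply/funext => u; exact: hk u.
by [].
Qed.

Lemma fsum_lab1 n c (v : vertex) X :
  \sum_(kappa \in lab n c [fset v]%fset) X kappa =
  \sum_(k <- incs n (c v)) X (fun u => if u == v then k else [::]).
Proof.
rewrite (fsbig_seq _ _ (incs_uniq n (c v))).
apply: (reindex_fsbig (fun k u => if u == v then k else [::])); split.
- by move=> k hk u; rewrite inE; case: eqP => [->|].
- by move=> k l _ _ /(congr1 (fun f => f v)); rewrite eqxx.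
- move=> k hk; exists (k v) => /=; first by have := hk v; rewrite inE eqxx.
  by apply/funext => u; have := hk u; rewrite inE; case: eqP => [->|].
Qed.

Definition push_label (j : nat) (kappa : vertex -> seq nat) (u : vertex) :=
  if u is h :: v then if h == j then kappa v else [::] else [::].

Lemma fsum_lab_graft n c j B X :
  \sum_(kappa \in lab n c (graft j B)) X kappa =
  \sum_(kappa \in lab n (fun v => c (j :: v)) B) X (push_label j kappa).
Proof.
apply: (reindex_fsbig (push_label j)); split.
- move=> k hk [|h v]; rewrite mem_graft //=.
  by rewrite eqseq_cons eqxx andbT; case: eqP => [->|] //=; exact: hk.
- move=> k l _ _ e; apply/funext => v; have := congr1 (fun f => f (j :: v)) e.
  by rewrite /= eqxx.
- move=> k hk; exists (fun v => k (j :: v)).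
    by move=> v; have := hk (j :: v); rewrite mem_graft eqxx.
  apply/funext => -[|h v] /=; first by have := hk [::]; rewrite mem_graft.
  case: eqP => [->//|hj]; have := hk (h :: v); rewrite mem_graft /= eqseq_cons.
  by rewrite (introF eqP hj).
Qed.

End Labels.

(** * Coefficients and expectations *)

Section Expectation.

Lemma card_increasing_bseq n j :
  #|[pred b : n.-bseq 'I_n | (size b == j) && sorted ltn [seq val k | k <- b]]| =
  'C(n, j).
Proof.
have [jn|nj] := leqP j n; last first.
  rewrite bin_small // eq_card0 // => b; rewrite !inE.
  by rewrite ltn_eqF // (leq_ltn_trans (size_bseq b)).
have sz (t : j.-tuple 'I_n) : (size t <= n)%N by rewrite size_tuple.
rewrite -card_ltn_sorted_tuples.
rewrite -(@card_in_imset _ _ (fun t : j.-tuple 'I_n => Bseq (sz t))); last first.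
  by move=> t u _ _ /(congr1 val) /= e; apply/val_inj.
apply: eq_card => b; rewrite inE; apply/andP/imsetP => [[/eqP sb so]|[t]].
  have sb' : size b == j by rewrite sb.
  by exists (Tuple sb'); [rewrite inE | exact: val_inj].
by rewrite inE => st ->; rewrite /= size_tuple.
Qed.

Lemma mem_internal (A : tree) u : (u \in internal A) = (u \in A) && (nsons A u != 0%N).
Proof. by rewrite !inE. Qed.

Lemma card_labellings n (A : tree) :
  #|[set kappa : {ffun internal A -> n.-bseq 'I_n} | is_labelling kappa]| = coef n A.
Proof.
rewrite cardsE.
transitivity #|family (fun u : internal A =>
    [pred b : n.-bseq 'I_n |
     (size b == nsons A (val u)) && sorted ltn [seq val k | k <- b]])|.
  by apply: eq_card => kappa; rewrite !inE.
rewrite card_family /image_mem foldrE big_map big_enum /=.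
rewrite (eq_bigr (fun u : internal A => 'C(n, nsons A (val u)))); last first.
  by move=> u _; rewrite card_increasing_bseq.
rewrite -(big_seq_fsetE _ _ predT (fun u => 'C(n, nsons A u))) /=.
rewrite /coef [RHS](bigID (fun u => nsons A u != 0%N)) /=.
have -> : (\prod_(u <- A | ~~ (nsons A u != 0%N)) 'C(n, nsons A u) = 1)%N.
  by apply: big1 => u /negPn/eqP->; rewrite bin0.
rewrite muln1 [RHS]big_fset_condE; apply: eq_fbigl => u.
by rewrite mem_internal.
Qed.

(** The coefficient is the number of labellings, which the normalisation of the
    expectation cancels. When [n] is too small for a labelling to exist, both
    sides are zero. *)
Lemma coef_expect {R : realType} {V : lmodType R} n (A : tree)
    (X : (vertex -> seq nat) -> V) :
  (coef n A)%:R *: expect n A X =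
  \sum_(kappa \in lab n (nsons A) (internal A)) X kappa.
Proof.
have -> : \sum_(kappa \in lab n (nsons A) (internal A)) X kappa =
    \sum_(kappa : {ffun internal A -> n.-bseq 'I_n} | is_labelling kappa) X (label kappa).
  rewrite (reindex_fsbig (@ffun_label n (internal A)) _ _ _ (ffun_label_bij _ _ _)).
  rewrite -[RHS]big_filter (fsbig_seq _ _ (filter_uniq _ (index_enum_uniq _))).
  congr (\sum_(i \in _) _); apply/seteqP; split => kappa /=.
    by rewrite mem_filter mem_index_enum andbT.
  by rewrite mem_filter => /andP[].
rewrite /expect card_labellings; have [c0|c0] := eqVneq (coef n A) 0%N; last first.
  by rewrite scalerA divff ?scale1r // pnatr_eq0.
rewrite c0 scale0r big_pred0 // => kappa; apply: contra_eqF c0 => h.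
by rewrite -card_labellings -lt0n; apply/card_gt0P; exists kappa; rewrite inE.
Qed.

End Expectation.

(** * Contribution of one tree *)

Section TreeSum.
Local Open Scope classical_set_scope.

Lemma zmod_morph_fsum {V : zmodType} (f : V -> V) {I : choiceType} (S : set I) F :
  @zmod_morphism V V f -> finite_set S ->
  f (\sum_(i \in S) F i) = \sum_(i \in S) f (F i).
Proof.
move=> hf fS; rewrite !(fsbig_finite _ _ fS) /=; exact: zmod_morph_sum.
Qed.

Fixpoint graft_upto (B : nat -> {fset vertex}) (m : nat) : {fset vertex} :=
  if m is m'.+1 then (graft_upto B m' `|` graft m'.+1 (B m'.+1))%fset else fset0.

Lemma mem_graft_upto B m u : (u \in graft_upto B m) =
  if u is h :: v then (0 < h <= m)%N && (v \in B h) else false.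
Proof.
elim: m u => [|m ih] u /=; first by rewrite in_fset0; case: u => // -[].
rewrite in_fsetU ih mem_graft; case: u => //= h v; rewrite eqseq_cons eqxx andbT.
by case: eqP => [->|] /=; [rewrite ltnn leqnn|lia].
Qed.

Context {V : zmodType}.
Local Notation additive := (@zmod_morphism V V).

(** Distributivity of the ordered product: the [j]-th factor only sees the
    labels of the vertices [j :: v], and the labels of different sons range
    independently. *)
Lemma fsum_opprod n c (B : nat -> {fset vertex})
    (g : nat -> (vertex -> seq nat) -> V -> V) (a : nat -> V -> V) m f :
  (forall j kappa, additive (g j kappa)) -> (forall j, additive (a j)) ->
  \sum_(kappa \in lab n c (graft_upto B m))
     opprod m (fun j => g j (fun v => kappa (j :: v)) \o a j) f =
  opprod m (fun j => (fun x => \sum_(kappa \in lab n (fun v => c (j :: v)) (B j))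
     g j kappa x) \o a j) f.
Proof.
move=> hg ha; elim: m => [|m ih]; first by rewrite fsum_lab0.
rewrite [graft_upto _ _]/= fsum_labU; last first.
  apply/fdisjointP => -[|h v]; rewrite mem_graft_upto //= => /andP[hm _].
  by rewrite mem_graft /= eqseq_cons; apply/negP => /andP[/andP[/eqP]]; lia.
rewrite [RHS]/= -ih (zmod_morph_fsum _ (ha _) (lab_finite _ _ _)).
transitivity (\sum_(kappa \in lab n c (graft_upto B m))
  \sum_(kappa' \in lab n (fun v => c (m.+1 :: v)) (B m.+1))
    g m.+1 kappa' (a m.+1 (opprod m (fun j => g j (fun v => kappa (j :: v)) \o a j) f))).
  apply: eq_fsbigr => kappa /set_mem hk; rewrite fsum_lab_graft.
  apply: eq_fsbigr => kappa' _.
  rewrite -[LHS]/(g m.+1 (fun v => kappa (m.+1 :: v) ++ push_label m.+1 kappa' (m.+1 :: v))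
    (a m.+1 (opprod m (fun j =>
       g j (fun v => kappa (j :: v) ++ push_label m.+1 kappa' (j :: v)) \o a j) f))).
  have -> : (fun v => kappa (m.+1 :: v) ++ push_label m.+1 kappa' (m.+1 :: v)) = kappa'.
    apply/funext => v /=; rewrite eqxx.
    by have := hk (m.+1 :: v); rewrite mem_graft_upto ltnn andbF => ->.
  congr (g _ _ (a _ _)); apply: eq_opprod => j /andP[_ jm] x /=.
  congr (g _ _ _); apply/funext => v.
  by rewrite ltn_eqF ?ltnS ?cats0.
rewrite exchange_fsbig //; try exact: lab_finite.
apply: eq_fsbigr => kappa' _.
by rewrite (zmod_morph_fsum _ (hg _ _) (lab_finite _ _ _)).
Qed.

Lemma zmod_morph_opprod m (op : nat -> V -> V) :
  (forall j, additive (op j)) -> additive (opprod m op).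
Proof. by move=> h; elim: m => [//|m ih] x y /=; rewrite ih h. Qed.

Variables (n : nat) (Q : nat -> V -> V).
Hypothesis Qadd : forall l, additive (Q l).

Lemma Gamma_additive l (A : tree) kappa : additive (Gamma n Q l A kappa).
Proof.
rewrite /Gamma; move: #|` A|%fset => p; elim: p l A kappa => [//|p ih] l A kappa /=.
case: ifP => _ x y.
  by rewrite (zmod_morph_iter _ (Qadd _)) Qadd !opprD !opprK addrACA.
apply: (zmod_morph_comp (zmod_morph_iter _ (Qadd _))).
apply: zmod_morph_opprod => j.
exact: zmod_morph_comp (ih _ _ _) (zmod_morph_iter _ (Qadd _)).
Qed.

(** This is $c(A) E[\Gamma_l^A]$, by [coef_expect]. *)
Definition tree_sum l (A : tree) (f : V) : V :=
  \sum_(kappa \in lab n (nsons A) (internal A)) Gamma n Q l A kappa f.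

Lemma tree_sum_additive l A : additive (tree_sum l A).
Proof.
move=> x y; rewrite /tree_sum !(fsbig_finite _ _ (lab_finite _ _ _)) /= -sumrB.
by apply: eq_bigr => kappa _; exact: Gamma_additive.
Qed.

Lemma nsons_subtree (A : tree) j v : is_tree A -> (0 < j <= nsons A [::])%N ->
  nsons (subtree A j) v = nsons A (j :: v).
Proof.
move=> tA hj; have tS := subtree_is_tree tA hj.
have h i : (0 < i)%N -> (i <= nsons (subtree A j) v)%N = (i <= nsons A (j :: v))%N.
  by move=> i0; rewrite !leq_nsons // mem_subtree.
apply/eqP; rewrite eqn_leq; apply/andP; split.
  by case e: (nsons _ _) => [//|k]; rewrite -h // e.
by case e: (nsons A _) => [//|k]; rewrite h // e.
Qed.

Lemma head_le_nsons (A : tree) h v : is_tree A -> h :: v \in A ->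
  (0 < h <= nsons A [::])%N.
Proof.
move=> tA; case: (tA) => posA _ preA _; elim/last_ind: v => [hA|v x ih].
  have h0 : (0 < h)%N by have := posA _ hA; rewrite inE eq_sym lt0n.
  by rewrite h0 leq_nsons.
by rewrite -rcons_cons => /preA/ih.
Qed.

Lemma internal_graft (A : tree) : is_tree A -> nsons A [::] != 0%N ->
  internal A =
  ([fset [::]] `|` graft_upto (fun j => internal (subtree A j)) (nsons A [::]))%fset.
Proof.
move=> tA sA; apply/fsetP => u.
rewrite in_fsetU mem_graft_upto in_fset1 mem_internal; case: u => [|h v] /=.
  by rewrite sA andbT; case: tA.
apply/idP/idP => [/andP[hA]|/andP[hh]]; last first.
  by rewrite mem_internal mem_subtree nsons_subtree.
have hh := head_le_nsons tA hA.
by rewrite hh mem_internal mem_subtree hA nsons_subtree.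
Qed.

Lemma tree_sum_leaf l (A : tree) f : is_tree A -> nsons A [::] = 0%N ->
  tree_sum l A f = iter n (Q l.+1) f - Q l f.
Proof.
move=> tA sA; rewrite /tree_sum.
have -> : internal A = fset0.
  apply/fsetP => u; rewrite mem_internal in_fset0; case: u => [|h v].
    by rewrite sA andbF.
  by apply/negP => /andP[/(head_le_nsons tA)]; rewrite sA; lia.
by rewrite fsum_lab0 Gamma_eq // sA.
Qed.

(** The sum over the label of the root is kept; the labels of the
    subtrees are summed inside the product, by [fsum_opprod]. *)
Lemma tree_sum_eq l (A : tree) f : is_tree A -> nsons A [::] != 0%N ->
  let i := nsons A [::] in
  tree_sum l A f =
  \sum_(k <- incs n i) iter (n - kap' k i) (Q l.+1)
    (opprod i (fun j => tree_sum l.+1 (subtree A j) \o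
                        iter (kap k j - kap' k j.-1) (Q l.+1)) f).
Proof.
move=> tA sA i; rewrite /tree_sum internal_graft // fsum_labU; last first.
  by apply/fdisjointP => u; rewrite in_fset1 => /eqP ->; rewrite mem_graft_upto.
rewrite fsum_lab1 -/i; apply: eq_bigr => k _.
pose a j := iter (kap k j - kap' k j.-1) (Q l.+1).
pose g j kappa := Gamma n Q l.+1 (subtree A j) kappa.
transitivity (iter (n - kap' k i) (Q l.+1) (\sum_(kappa \in
    lab n (nsons A) (graft_upto (fun j => internal (subtree A j)) i))
    opprod i (fun j => g j (fun v => kappa (j :: v)) \o a j) f)).
  rewrite (zmod_morph_fsum _ (zmod_morph_iter _ (Qadd _)) (lab_finite _ _ _)).
  apply: eq_fsbigr => kappa /set_mem hk; rewrite Gamma_eq // (negbTE sA) /= -/i.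
  by have := hk [::]; rewrite mem_graft_upto => ->; rewrite cats0.
congr (iter _ _ _); rewrite fsum_opprod; [|by move=> *; exact: Gamma_additive|
  by move=> j; exact: zmod_morph_iter].
apply: eq_opprod => j hj x /=.
have -> // : (fun v => nsons A (j :: v)) = nsons (subtree A j).
by apply/funext => v; rewrite nsons_subtree.
Qed.

End TreeSum.

(** * Sums over the family F(T) *)

Section Families.
Implicit Types (A S T : tree) (FF : {fset tree}).

(** Both the elements of [tensor FF m] ([tensor_joint]) and the trees
    $T_l^\nu$ ([treeT_joint]) have this form, which gives direct access to
    their subtrees. *)
Definition joint (B : nat -> tree) (m : nat) : tree :=
  (root_tree `|` graft_upto B m)%fset.

Lemma mem_joint B m u : (u \in joint B m) =
  if u is h :: v then (0 < h <= m)%N && (v \in B h) else true.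
Proof. by rewrite in_fsetU in_fset1 mem_graft_upto; case: u. Qed.

Lemma subtree_joint B m j : (0 < j <= m)%N -> subtree (joint B m) j = B j.
Proof. by move=> jm; apply/fsetP => v; rewrite mem_subtree mem_joint jm. Qed.

Lemma joint_is_tree B m : (forall j, (0 < j <= m)%N -> is_tree (B j)) ->
  is_tree (joint B m).
Proof.
move=> tB; split=> [u|||]; rewrite ?mem_joint //.
- case: u => [//|h v] /andP[hm vB].
  have [posB _ _ _] := tB h hm; case/andP: hm => h0 _.
  by rewrite inE negb_or posB // andbT eq_sym -lt0n.
- case=> [|h v] j; rewrite ?rcons_cons !mem_joint //= => /andP[hm vB].
  by rewrite hm; case: (tB h hm) => _ _ preB _; exact: preB vB.
- case=> [|h v] i j ij; rewrite ?rcons_cons !mem_joint /=.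
    move=> /andP[jm _]; have im : (0 < i <= m)%N by lia.
    by rewrite im; case: (tB i im).
  by move=> /andP[hm vB]; rewrite hm; case: (tB h hm) => _ _ _ sibB; exact: sibB vB.
Qed.

Lemma nsons_joint B m : (forall j, (0 < j <= m)%N -> is_tree (B j)) ->
  nsons (joint B m) [::] = m.
Proof.
move=> tB; have tJ := joint_is_tree tB.
have h i : (0 < i)%N -> (i <= nsons (joint B m) [::])%N = (i <= m)%N.
  move=> i0; rewrite leq_nsons // mem_joint /= i0 /=.
  by case: leqP => //= im; case: (tB i) => //; rewrite i0.
apply/eqP; rewrite eqn_leq; apply/andP; split.
  by case e: (nsons _ _) => [//|k]; rewrite -h // e.
by case: m h {tB tJ} => [//|k] h; rewrite h.
Qed.

Lemma tensor_joint FF m A : A \in tensor FF m ->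
  A = joint (subtree A) m /\ forall j, (0 < j <= m)%N -> subtree A j \in FF.
Proof.
elim: m A => [|m ih] A /=.
  rewrite in_fset1 => /eqP->; split=> [|j]; last by lia.
  by apply/fsetP => -[|h v]; rewrite mem_joint in_fset1 //; case: h.
case/imfset2P => A' /= /ih[eA' hA'] [S /= hS] ->.
have memU h v : (h :: v \in (A' `|` graft m.+1 S)%fset) =
    ((0 < h <= m)%N && (v \in subtree A' h)) || (h == m.+1) && (v \in S).
  rewrite in_fsetU mem_graft /= eqseq_cons eqxx andbT {1}eA' mem_joint.
  by [].
split=> [|j jm].
  apply/fsetP => -[|h v]; rewrite mem_joint ?mem_subtree.
    by rewrite in_fsetU eA' mem_joint.
  by rewrite memU; have [->|hm] := eqVneq h m.+1; rewrite ?ltnn /=; lia.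
have [->|nj] := eqVneq j m.+1.
  suff -> : subtree (A' `|` graft m.+1 S)%fset m.+1 = S by [].
  by apply/fsetP => v; rewrite mem_subtree memU ltnn eqxx.
have jm' : (0 < j <= m)%N by lia.
suff -> : subtree (A' `|` graft m.+1 S)%fset j = subtree A' j by exact: hA'.
by apply/fsetP => v; rewrite mem_subtree memU jm' (negbTE nj) orbF.
Qed.

Lemma subtree_add_graft FF m A S : A \in tensor FF m ->
  subtree (A `|` graft m.+1 S)%fset m.+1 = S /\
  forall j, (0 < j <= m)%N -> subtree (A `|` graft m.+1 S)%fset j = subtree A j.
Proof.
move=> /tensor_joint[eA _].
split=> [|j jm]; apply/fsetP => v.
  rewrite mem_subtree in_fsetU mem_graft eqxx eA mem_joint ltnn andbF.
  by [].
rewrite !mem_subtree in_fsetU mem_graft /= eqseq_cons eqxx andbT.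
by rewrite ltn_eqF ?orbF // ltnS; case/andP: jm.
Qed.

Lemma tensor_is_tree FF m A : (forall S, S \in FF -> is_tree S) ->
  A \in tensor FF m -> is_tree A /\ nsons A [::] = m.
Proof.
move=> tF /tensor_joint[eA hA]; rewrite eA.
by split; [apply: joint_is_tree|apply: nsons_joint] => j jm; exact: tF (hA j jm).
Qed.

Lemma treeF_members T A : is_tree T -> A \in treeF T -> is_tree A.
Proof.
move: {-1}#|` T|%fset (leqnn #|` T|%fset) => N; elim: N T A => [|N ih] T A hN tT.
  by case: (tT) => _ T0 _ _; move: hN; rewrite leqn0 cardfs_eq0 => /eqP e; rewrite e in T0.
rewrite treeF_eq // in_fsetU in_fset1 => /orP[/eqP->|].
  have := @joint_is_tree (fun=> root_tree) 0; rewrite /joint fsetU0; apply.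
  by move=> j; lia.
case/bigfcupP => i; rewrite mem_index_iota ltnS andbT => hi.
case/tensor_is_tree => // S; apply: ih; last exact: subtree_is_tree.
by have := card_subtree i tT; lia.
Qed.

(** The tree reduced to its root is the tensor power of order [0]. The whole
    family is then one union, which is disjoint since the order of the power is
    the number of sons of the root. *)
Lemma treeF_bigcup T : is_tree T -> treeF T =
  (\bigcup_(i <- index_iota 0 (nsons T [::]).+1) tensor (treeF (subtree T i)) i)%fset.
Proof. by move=> tT; rewrite treeF_eq // [in RHS]/index_iota subn0 /= big_cons /index_iota subSS subn0. Qed.

Context {V : zmodType}.
Local Notation additive := (@zmod_morphism V V).

(** Distributivity again: an element of the tensor power is determined by its
    subtrees, which range independently over [FF]. *)
Lemma sum_tensor FF (g : tree -> V -> V) (a : nat -> V -> V) m f :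
  (forall S, additive (g S)) -> (forall j, additive (a j)) ->
  \sum_(A <- tensor FF m) opprod m (fun j => g (subtree A j) \o a j) f =
  opprod m (fun j => (fun x => \sum_(S <- FF) g S x) \o a j) f.
Proof.
move=> hg ha; elim: m => [|m ih]; first by rewrite /= big_seq_fset1.
rewrite [RHS]/= -ih [tensor _ _]/= big_imfset2 /=; last first.
  move=> [A S] [A' S']; rewrite !inE /= => /andP[hA hS] /andP[hA' hS'] e.
  have [eS eA] := subtree_add_graft S hA; have [eS' eA'] := subtree_add_graft S' hA'.
  have -> : A = A'.
    have [jA _] := tensor_joint hA; have [jA' _] := tensor_joint hA'.
    apply/fsetP => -[|h v]; rewrite jA jA' !mem_joint //.
    by case hm: (0 < h <= m)%N => //=; rewrite -eA // e eA'.
  by congr (Tagged _ _); rewrite -eS e.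
rewrite exchange_big; apply: eq_bigr => S _ /=.
rewrite (zmod_morph_sum _ _ _ (ha _)) (zmod_morph_sum _ _ _ (hg _)).
rewrite big_seq [RHS]big_seq; apply: eq_bigr => A hA.
have [-> eA] := subtree_add_graft S hA; congr (g _ (a _ _)).
by apply: eq_opprod => j jm x /=; rewrite eA.
Qed.

Lemma sum_bigfcup {K : choiceType} (F : nat -> {fset K}) (h : K -> nat) r (f : K -> V) :
  uniq r -> (forall i x, i \in r -> x \in F i -> h x = i) ->
  \sum_(x <- (\bigcup_(i <- r) F i)%fset) f x = \sum_(i <- r) \sum_(x <- F i) f x.
Proof.
move=> ur hF; have e i : i \in seq_fset tt r = (i \in r) by rewrite seq_fsetE.
have pr : perm_eq (seq_fset tt r) r by rewrite -[X in perm_eq _ X]undup_id // seq_fset_perm.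
rewrite -(perm_big _ pr) -[RHS](perm_big _ pr).
apply: partition_disjoint_bigfcup => i j; rewrite !e => ir jr ij.
apply/fdisjointP => x xi; apply: contra ij => xj.
by rewrite -(hF i x ir xi) -(hF j x jr xj).
Qed.

End Families.

(** * Recursion for the whole family *)

Section Correction.
Context {V : zmodType}.
Local Notation additive := (@zmod_morphism V V).
Variables (n : nat) (Q : nat -> V -> V).
Hypothesis Qadd : forall l, additive (Q l).

Definition correction (l : nat) (T : tree) (f : V) : V :=
  \sum_(A <- treeF T) tree_sum n Q l A f.

Lemma correction_additive l T : additive (correction l T).
Proof. by apply: zmod_morph_bigsum => A; exact: tree_sum_additive. Qed.

(** The tree reduced to its root replaces [Q l] by the word without a letter
    [B]; the trees with [i] sons give the words with [i] letters [B], where [B] is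
    itself a correction, one level deeper, for the [i]-th subtree of [T]. *)
Lemma correction_eq l (T : tree) f : is_tree T ->
  correction l T f = iter n (Q l.+1) f - Q l f +
  \sum_(1 <= i < (nsons T [::]).+1) \sum_(t < n.+1) iter (n - t) (Q l.+1)
    (words (Q l.+1) (correction l.+1 (subtree T i)) f i t).
Proof.
move=> tT; rewrite /correction treeF_bigcup //.
have tF i S : (0 < i <= nsons T [::])%N -> S \in treeF (subtree T i) -> is_tree S.
  by move=> hi; apply: treeF_members; exact: subtree_is_tree.
rewrite (@sum_bigfcup _ _ _ (fun A => nsons A [::])); last 2 first.
- exact: iota_uniq.
- move=> [|i] A; rewrite mem_index_iota ltnS => hi.
    by move=> hA; have [S|] := @tensor_is_tree fset0 0 A _ hA; rewrite ?in_fset0.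
  by move=> hA; have [] := tensor_is_tree (fun S => tF i.+1 S hi) hA.
rewrite big_ltn // big_seq_fset1; congr (_ + _).
  have t0 j : (0 < j <= 0)%N -> is_tree fset0 by lia.
  have := joint_is_tree t0; have := nsons_joint t0; rewrite /joint fsetU0.
  by move=> s0 tr; rewrite tree_sum_leaf.
apply: eq_big_nat => i hi; have {}hi : (0 < i <= nsons T [::])%N by lia.
rewrite -(@sum_incs_words _ n i (Q l.+1) (correction l.+1 (subtree T i))
  (fun t => iter (n - t) (Q l.+1)) f (Qadd _) (@correction_additive _ _)
  (fun t => zmod_morph_iter (n - t) (Qadd _))).
transitivity (\sum_(A <- tensor (treeF (subtree T i)) i)
  \sum_(k <- incs n i) iter (n - kap' k i) (Q l.+1)
    (opprod i (fun j => tree_sum n Q l.+1 (subtree A j) \o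
                        iter (kap k j - kap' k j.-1) (Q l.+1)) f)).
  rewrite big_seq [RHS]big_seq; apply: eq_bigr => A hA.
  have [tA sA] := tensor_is_tree (fun S => tF i S hi) hA.
  by rewrite tree_sum_eq // sA //; case/andP: hi; rewrite lt0n.
rewrite exchange_big; apply: eq_bigr => k _ /=.
rewrite -(zmod_morph_sum _ _ _ (zmod_morph_iter _ (Qadd _))); congr (iter _ _ _).
apply: (@sum_tensor _ _ (fun S => tree_sum n Q l.+1 S)
  (fun j => iter (kap k j - kap' k j.-1) (Q l.+1))) => [S|j].
  exact: tree_sum_additive.
exact: zmod_morph_iter.
Qed.

End Correction.

Lemma Qhat_correction {R : realType} {V : lmodType R} n (Q : nat -> V -> V) T f :
  Qhat n Q T f = Q 0%N f + correction n Q 0 T f.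
Proof. by congr (_ + _); apply: eq_bigr => A _; rewrite coef_expect. Qed.

Lemma treeT_joint {R : realType} (alpha : R) l nu : 0 < alpha ->
  treeT alpha l nu =
  joint (fun i => treeT alpha l.+1 (qidx alpha l nu i)) (mval alpha l nu).-1.
Proof.
move=> a0; rewrite treeT_eq //; apply/fsetP => u; rewrite mem_joint in_fsetU in_fset1.
case: u => [//|h v]; rewrite orFb; apply/bigfcupP/andP => [[i]|[hm vT]].
  rewrite mem_index_iota andbT mem_graft /= => im /andP[/eqP[->] ->]; split => //; lia.
by exists h; rewrite ?mem_index_iota ?mem_graft ?eqxx ?andbT //; lia.
Qed.

(** * The norms on smooth bounded functions *)

Section Norms.
Context {R : realType} {d : nat}.
Implicit Types (x y : 'rV[R]_d) (f g : Cb R d).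

(** The squares of [enorm y * x 0 i - enorm x * y 0 i] have a nonnegative sum;
    expanding it gives the inequality multiplied by [2 * enorm x * enorm y],
    so that the case of a zero norm is treated apart. *)
Lemma enorm_cauchy_schwarz x y : \sum_i x 0 i * y 0 i <= enorm x * enorm y.
Proof.
have sq (z : 'rV[R]_d) : \sum_i z 0 i ^+ 2 = enorm z ^+ 2.
  by rewrite sqr_sqrtr // sumr_ge0 // => i _; exact: sqr_ge0.
have [a0 b0] := (enorm_ge0 x, enorm_ge0 y).
have [ab0|ab0] := eqVneq (enorm x * enorm y) 0.
  rewrite ab0 big1 // => i _; apply/eqP; rewrite -normr_le0 normrM -ab0.
  by rewrite ler_pM // coord_le_enorm.
have {ab0}ab0 : 0 < enorm x * enorm y by rewrite lt_def ab0 mulr_ge0.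
rewrite -(ler_pM2l ab0) -subr_ge0.
have : 0 <= \sum_i (enorm y * x 0 i - enorm x * y 0 i) ^+ 2.
  by apply: sumr_ge0 => i _; exact: sqr_ge0.
under eq_bigr => i _ do rewrite sqrrB !exprMn -mulrnAr.
rewrite big_split sumrB /= -!mulr_sumr !sq.
have -> : \sum_i enorm y * x 0 i * (enorm x * y 0 i *+ 2) =
  2 * (enorm x * enorm y * \sum_i x 0 i * y 0 i).
  by rewrite !mulr_sumr; apply: eq_bigr => i _; ring.
by move: (\sum_i _) => s; lra.
Qed.

Lemma ler_enormD x y : enorm (x + y) <= enorm x + enorm y.
Proof.
rewrite -(@ler_pXn2r _ 2) ?nnegrE ?addr_ge0 ?enorm_ge0 //.
rewrite sqr_sqrtr ?sumr_ge0 // => [|i _]; last exact: sqr_ge0.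
under eq_bigr => i _ do rewrite mxE sqrrD.
rewrite !big_split /= -mulr2n sqrrD !sqr_sqrtr ?sumr_ge0 //; try by move=> i _; exact: sqr_ge0.
by rewrite lerD2r lerD2l lerMn2r enorm_cauchy_schwarz.
Qed.

Lemma enormN x : enorm (- x) = enorm x.
Proof. by congr Num.sqrt; apply: eq_bigr => i _; rewrite mxE sqrrN. Qed.

Lemma cb_smooth f : smooth f.
Proof. by case: f => f /= /asboolP[]. Qed.

Lemma cb_has_sup f s :
  has_sup [set enorm (partials s f x) | x in [set: 'rV[R]_d]]%classic.
Proof.
split; first by exists (enorm (partials s f 0)), 0.
have [M hM] : exists M : R, forall x, enorm (partials s f x) <= M.
  by case: f => f /= /asboolP[_]; apply.
by exists M => _ [x _ <-].
Qed.

Lemma cbsup_ge f s x :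
  enorm (partials s f x) <=
  sup [set enorm (partials s f x) | x in [set: 'rV[R]_d]]%classic.
Proof. by apply: ub_le_sup; [case: (cb_has_sup f s)|exists x]. Qed.

Lemma cbsup_ge0 f s :
  0 <= sup [set enorm (partials s f x) | x in [set: 'rV[R]_d]]%classic.
Proof. exact: le_trans (enorm_ge0 _) (cbsup_ge f s 0). Qed.

Lemma partials_add f g s x :
  partials s (f + g : Cb R d) x = partials s f x + partials s g x.
Proof.
have -> : cbfun (f + g) = 1 *: cbfun f + cbfun g by rewrite scale1r.
by rewrite partials_linear ?scale1r //; exact: cb_smooth.
Qed.

Lemma partials0 s x : partials s (0 : Cb R d) x = 0.
Proof. by have -> : cbfun (0 : Cb R d) = 0 by []; rewrite smooth0. Qed.

Lemma partials_opp f s x : partials s (- f : Cb R d) x = - partials s f x.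
Proof.
by apply/eqP; rewrite -addr_eq0 -partials_add addNr partials0.
Qed.

Lemma cbnorm_ge0 k f : 0 <= cbnorm k f.
Proof. by apply: sumr_ge0 => i _; exact: cbsup_ge0. Qed.

Lemma cbnorm0 k : cbnorm k (0 : Cb R d) = 0.
Proof.
apply: big1 => gamma _; rewrite -[RHS](@sup1 R 0); congr sup.
apply/seteqP; split => [_ [x _ <-]|_ ->]; first by rewrite /mpartial partials0 enorm0.
by exists 0 => //; rewrite /mpartial partials0 enorm0.
Qed.

Lemma cbnormN k f : cbnorm k (- f) = cbnorm k f.
Proof.
apply: eq_bigr => gamma _; congr sup; apply: eq_imagel => x _.
by rewrite /mpartial partials_opp enormN.
Qed.

Lemma ler_cbnormD k f g : cbnorm k (f + g) <= cbnorm k f + cbnorm k g.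
Proof.
rewrite -big_split /=; apply: ler_sum => gamma _; apply: ge_sup.
  by exists (enorm (mpartial (fun i => gamma i) (f + g) 0)), 0.
move=> _ [x _ <-]; rewrite /mpartial partials_add.
by rewrite (le_trans (ler_enormD _ _)) // lerD // cbsup_ge.
Qed.

Lemma ler_cbnormB k f g : cbnorm k (f - g) <= cbnorm k f + cbnorm k g.
Proof. by rewrite -(cbnormN k g); exact: ler_cbnormD. Qed.

Lemma ler_cbnorm_sum k I (r : seq I) (p : pred I) (F : I -> Cb R d) :
  cbnorm k (\sum_(i <- r | p i) F i) <= \sum_(i <- r | p i) cbnorm k (F i).
Proof.
elim/big_ind2: _ => [|x1 x2 y1 y2 h1 h2|//]; first by rewrite cbnorm0.
exact: le_trans (ler_cbnormD _ _ _) (lerD h1 h2).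
Qed.

(** The multi-indices of length at most [k] are the same functions in the two
    index types, which differ by the bound on the entries only. *)
Lemma cbnorm_le k k' f : (k <= k')%N -> cbnorm k f <= cbnorm k' f.
Proof.
rewrite -ltnS => kk; pose h (gamma : {ffun 'I_d -> 'I_k.+1}) :=
  [ffun i => widen_ord kk (gamma i)].
pose h' (gamma : {ffun 'I_d -> 'I_k'.+1}) : {ffun 'I_d -> 'I_k.+1} :=
  [ffun i => inord (gamma i)].
rewrite [leRHS](bigID (fun gamma : {ffun 'I_d -> 'I_k'.+1} => (\sum_i gamma i <= k)%N)) /=.
rewrite -[leLHS]addr0 lerD //; last by apply: sumr_ge0 => i _; exact: cbsup_ge0.
rewrite [leRHS](reindex_onto h h'); last first.
  move=> gamma /andP[_ gk]; apply/ffunP => i; rewrite !ffunE; apply/val_inj => /=.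
  by rewrite inordK // ltnS (leq_trans _ gk) // (bigD1 i) //= leq_addr.
rewrite le_eqVlt; apply/orP; left; apply/eqP; apply: eq_big => gamma.
  have -> : (\sum_i h gamma i = \sum_i gamma i)%N.
    by apply: eq_bigr => i _; rewrite ffunE.
  have -> : h' (h gamma) == gamma.
    by apply/eqP/ffunP => i; rewrite !ffunE; apply/val_inj; rewrite /= inordK.
  by rewrite andbT; apply/idP/andP => [gk|[]//]; split => //; exact: leq_trans gk kk.
move=> _; congr sup; apply: eq_imagel => x _; congr (enorm (mpartial _ f x)).
by apply/funext => i; rewrite ffunE.
Qed.

End Norms.

(** * Size of the words *)

Section WordBounds.
Context {R : realType} {d : nat}.
Local Notation V := (Cb R d).

Lemma ler_sum_triangle (X : nat -> R) n : (forall s, 0 <= X s) ->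
  \sum_(t < n.+1) \sum_(s < t) X s <= n%:R * \sum_(s < n.+1) X s.
Proof.
move=> X0; rewrite big_ord_recl big_ord0 add0r mulr_natl -[X in _ *+ X]card_ord.
rewrite -sumr_const; apply: ler_sum => t _ /=.
rewrite -(big_mkord predT X) -[leRHS](big_mkord predT X).
have tn : (bump 0 t <= n.+1)%N by rewrite /bump; have := ltn_ord t; lia.
rewrite [leRHS](big_cat_nat (n := bump 0 t)) //= lerDl.
by apply: sumr_ge0 => s _.
Qed.

(** The constants of [words_bound] and [words_diff_bound] are functions of those
    that bound the letters, hence uniform in [n]. They are taken at shifted
    indices because each letter [B] uses [kappa] derivatives. *)
Fixpoint words_cst (kappa : nat) (cq cB : nat -> R) (i m : nat) : R :=
  if i is i'.+1 then
    cB m * cq (m + kappa)%N * words_cst kappa cq cB i' (m + kappa)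
  else 1.

Fixpoint diff_cst (kappa : nat) (cq cB cE : nat -> R) (i m : nat) : R :=
  if i is i'.+1 then
    cq (m + kappa)%N * (cB m * diff_cst kappa cq cB cE i' (m + kappa) +
                        cE m * words_cst kappa cq cB i' (m + kappa))
  else 0.

Variables (kappa : nat) (cq cB : nat -> R).
Hypotheses (cq_ge0 : forall m, 0 <= cq m) (cB_ge0 : forall m, 0 <= cB m).

Lemma words_cst_ge0 i m : 0 <= words_cst kappa cq cB i m.
Proof. by elim: i m => [|i ih] m //=; rewrite !mulr_ge0. Qed.

Variables (n : nat) (q B : V -> V) (eps : R).
Hypothesis eps_ge0 : 0 <= eps.
Hypothesis q_bound : forall m k g, (k <= n)%N ->
  cbnorm m (iter k q g) <= cq m * cbnorm m g.
Hypothesis B_bound : forall m g,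
  cbnorm m (B g) <= cB m * eps * cbnorm (m + kappa) g.

(** A new letter [B] costs [eps] and has at most [n] possible positions, hence
    one factor [n * eps] per letter. *)
Lemma words_bound f i m :
  \sum_(t < n.+1) cbnorm m (words q B f i t) <=
  words_cst kappa cq cB i m * (n%:R * eps) ^+ i * cbnorm (m + i * kappa) f.
Proof.
elim: i m => [|i ih] m.
  rewrite big_ord_recl big1 ?addr0 //= => [|t _]; last exact: cbnorm0.
  by rewrite expr0 !mul1r mul0n addn0.
pose X s := cB m * eps * (cq (m + kappa)%N * cbnorm (m + kappa) (words q B f i s)).
have X0 s : 0 <= X s by rewrite !mulr_ge0 ?cbnorm_ge0.
apply: (@le_trans _ _ (\sum_(t < n.+1) \sum_(s < t) X s)).
  apply: ler_sum => t _; apply: le_trans (ler_cbnorm_sum _ _ _ _) _.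
  apply: ler_sum => s _; apply: le_trans (B_bound _ _) _.
  apply: ler_wpM2l; first exact: mulr_ge0.
  by apply: q_bound; have := ltn_ord t; lia.
apply: le_trans (ler_sum_triangle n X0) _.
rewrite -!mulr_sumr [words_cst _ _ _ _ _]/= exprS mulSn addnA.
have := ih (m + kappa)%N; move: (\sum_(_ < _) _) => S hS.
have : 0 <= cB m * cq (m + kappa)%N * (n%:R * eps) by rewrite !mulr_ge0.
move=> /ler_wpM2l /(_ _ _ hS) h.
rewrite [leLHS](_ : _ = cB m * cq (m + kappa)%N * (n%:R * eps) * S); last by ring.
by rewrite [leRHS](_ : _ = cB m * cq (m + kappa)%N * (n%:R * eps) *
  (words_cst kappa cq cB i (m + kappa) * (n%:R * eps) ^+ i *
   cbnorm (m + kappa + i * kappa) f)) //; ring.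
Qed.

Variables (cE : nat -> R) (D : V -> V) (delta : R).
Hypotheses (cE_ge0 : forall m, 0 <= cE m) (delta_ge0 : 0 <= delta).

Lemma diff_cst_ge0 i m : 0 <= diff_cst kappa cq cB cE i m.
Proof.
elim: i m => [|i ih] m //=.
by rewrite mulr_ge0 // addr_ge0 ?mulr_ge0 // words_cst_ge0.
Qed.

Hypothesis q_add : @zmod_morphism V V q.
Hypothesis D_add : @zmod_morphism V V D.
Hypothesis D_bound : forall m g,
  cbnorm m (D g) <= cB m * eps * cbnorm (m + kappa) g.
Hypothesis BD_bound : forall m g,
  cbnorm m (B g - D g) <= cE m * delta * cbnorm (m + kappa) g.

(** With [B x - D y = D (x - y) + (B x - D x)], either the difference is carried by
    a shorter word, or it is made at the last letter. Exactly one letter then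
    contributes [delta] in place of [eps]; multiplying the left-hand side by
    [eps] avoids the exponent [i - 1]. *)
Lemma words_diff_bound f i m :
  eps * \sum_(t < n.+1) cbnorm m (words q B f i t - words q D f i t) <=
  diff_cst kappa cq cB cE i m * (n%:R * eps) ^+ i * delta *
    cbnorm (m + i * kappa) f.
Proof.
elim: i m => [|i ih] m.
  by rewrite big1 ?mulr0 ?mul0r //= => t _; rewrite subrr cbnorm0.
pose X s := cB m * eps *
    (cq (m + kappa)%N * cbnorm (m + kappa) (words q B f i s - words q D f i s)) +
  cE m * delta * (cq (m + kappa)%N * cbnorm (m + kappa) (words q B f i s)).
have X0 s : 0 <= X s by rewrite addr_ge0 // !mulr_ge0 ?cbnorm_ge0.
apply: (@le_trans _ _ (eps * \sum_(t < n.+1) \sum_(s < t) X s)).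
  apply: ler_wpM2l => //; apply: ler_sum => t _; rewrite !wordsS -sumrB.
  apply: le_trans (ler_cbnorm_sum _ _ _ _) _; apply: ler_sum => s _.
  set k := (t - s.+1)%N; set b := words q B f i s; set w := words q D f i s.
  have kn : (k <= n)%N by rewrite /k; have := ltn_ord t; lia.
  have -> : B (iter k q b) - D (iter k q w) =
      D (iter k q (b - w)) + (B (iter k q b) - D (iter k q b)).
    by rewrite (zmod_morph_iter _ q_add) D_add [RHS]addrC subrKA.
  apply: le_trans (ler_cbnormD _ _ _) _; apply: lerD.
    apply: le_trans (D_bound _ _) _; apply: ler_wpM2l; first exact: mulr_ge0.
    exact: q_bound.
  apply: le_trans (BD_bound _ _) _; apply: ler_wpM2l; first exact: mulr_ge0.
  exact: q_bound.
apply: le_trans (ler_wpM2l eps_ge0 (ler_sum_triangle n X0)) _.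
rewrite big_split /= -!mulr_sumr exprS mulSn addnA.
have := ih (m + kappa)%N; have := words_bound f i (m + kappa).
move: (\sum_(_ < _) _) (\sum_(_ < _) _) => S S' hS hS'.
have /ler_wpM2l/(_ _ _ hS) h1 : 0 <= n%:R * eps * (cE m * delta * cq (m + kappa)%N).
  by rewrite !mulr_ge0.
have /ler_wpM2l/(_ _ _ hS') h2 : 0 <= n%:R * eps * (cB m * cq (m + kappa)%N).
  by rewrite !mulr_ge0.
move: (lerD h2 h1) => {h1 h2 hS hS' X X0 ih}.
rewrite [diff_cst _ _ _ _ _ _]/=.
move: (cbnorm _ _) (diff_cst _ _ _ _ _ _) (words_cst _ _ _ _ _) => N a b.
move: ((_ * _) ^+ i) (cq _) (cB m) (cE m) => E x y z h.
by apply: (le_trans _ (le_trans h _)); rewrite le_eqVlt;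
  apply/orP; left; apply/eqP; ring.
Qed.

End WordBounds.

(** * Powers of n *)

Section Exponents.
Context {R : realType} (alpha : R) (alpha_gt0 : 0 < alpha).

Lemma le_mval l nu :
  nu%:R <= (mval alpha l nu)%:R * ((1 + alpha) * l%:R + alpha) :> R.
Proof. by rewrite leNgt -lt_mval // ltnn. Qed.

Lemma qidx_ge l nu i : (0 < i < mval alpha l nu)%N ->
  nu%:R + (i%:R - (1 + alpha) * l.+1%:R * (i%:R - 1)) <= (qidx alpha l nu i)%:R :> R.
Proof.
move=> im; have [_ e] := qidx_ceil alpha_gt0 im.
have -> : (qidx alpha l nu i)%:R = (qidx alpha l nu i)%:Z%:~R :> R by [].
by rewrite e intrD lerD // ceil_ge.
Qed.

(** The approximation of order [qidx] is at least as accurate as the operator that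
    it approximates is small, so that it has the size of that operator. *)
Lemma qidx_ge_order l nu i : (0 < i < mval alpha l nu)%N ->
  (1 + alpha) * l.+1%:R <= (qidx alpha l nu i)%:R :> R.
Proof.
move=> im; have := qidx_ge im; case/andP: im => _; rewrite lt_mval // -natr1.
by nra.
Qed.

Lemma kval_ge_remainder beta l nu : (beta * mval alpha l nu <= kval alpha beta l nu)%N.
Proof. by rewrite kval_eq // leq_maxl. Qed.

Lemma kval_ge_son beta l nu i : (0 < i < mval alpha l nu)%N ->
  (i * kval alpha beta l.+1 (qidx alpha l nu i) <= kval alpha beta l nu)%N.
Proof.
move=> im; rewrite [X in (_ <= X)%N]kval_eq // leq_max; apply/orP; right.
by apply: (@leq_bigmax_seq _ (index_iota _ _)); rewrite ?mem_index_iota.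
Qed.

(** Lets the local error be bounded with the loss of derivatives of its
    approximation, whose order is positive. *)
Lemma kval_ge_beta beta l nu : (0 < nu)%N -> (beta <= kval alpha beta l nu)%N.
Proof.
move=> nu0; apply: leq_trans (kval_ge_remainder _ _ _); apply: leq_pmulr.
by rewrite lt_mval // mul0r ltr0n.
Qed.

Variables (n : nat) (n_gt0 : (0 < n)%N).

Lemma powRMn (x : R) i : (n%:R `^ x) ^+ i = n%:R `^ (x * i%:R).
Proof. by rewrite powRrM powR_mulrn // powR_ge0. Qed.

Lemma powR_natN i : n%:R ^- i = n%:R `^ (- i%:R) :> R.
Proof. by rewrite powRN powR_mulrn. Qed.

Lemma powR_natD (x y : R) : n%:R `^ x * n%:R `^ y = n%:R `^ (x + y).
Proof. by rewrite powRD //; apply/implyP => _; rewrite pnatr_eq0 -lt0n. Qed.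

Definition local_order (l : nat) : R := n%:R `^ (- ((1 + alpha) * l.+1%:R)).

Lemma local_order_gt0 l : 0 < local_order l.
Proof. by apply: powR_gt0; rewrite ltr0n. Qed.

Lemma ler_powR_nat (x y : R) : x <= y -> n%:R `^ x <= n%:R `^ y.
Proof. by apply: ler_powR; rewrite ler1n. Qed.

(** One letter [D], together with the choice of its position, contributes
    $n^{-((1+\alpha)l+\alpha)}$. *)
Lemma mulr_local_order l i :
  (n%:R * local_order l) ^+ i = n%:R `^ (- ((1 + alpha) * l%:R + alpha) * i%:R).
Proof.
rewrite -powRMn; congr (_ ^+ _); rewrite /local_order.
rewrite -[X in X * _](powRr1 (ler0n R n)) powR_natD; congr (_ `^ _).
by rewrite -natr1; ring.
Qed.

Lemma remainder_order l nu :
  (n%:R * local_order l) ^+ mval alpha l nu <= n%:R ^- nu.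
Proof.
rewrite mulr_local_order powR_natN; apply: ler_powR_nat.
by have := le_mval l nu; lra.
Qed.

Lemma son_local_order l nu i : (0 < i < mval alpha l nu)%N ->
  n%:R ^- qidx alpha l nu i <= local_order l.
Proof.
by move=> im; rewrite powR_natN; apply: ler_powR_nat; rewrite lerN2 qidx_ge_order.
Qed.

(** The defining inequality of $q_i$: [i - 1] letters of the size of the local
    error, one letter of size $n^{-q_i}$ and [n ^ i] words. *)
Lemma son_order l nu i : (0 < i < mval alpha l nu)%N ->
  (n%:R * local_order l) ^+ i * n%:R ^- qidx alpha l nu i <=
  local_order l * n%:R ^- nu.
Proof.
move=> im; rewrite mulr_local_order !powR_natN !powR_natD; apply: ler_powR_nat.
by have := qidx_ge im; rewrite -natr1; lra.
Qed.

End Exponents.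

(** * Convergence *)

Lemma le_cst {R : realType} (a x y : R) : 0 <= a -> 0 <= x -> x <= y ->
  a * x <= (a + 1) * y.
Proof. by move=> a0 x0 xy; apply: ler_pM => //; rewrite lerDl. Qed.

Section Convergence.
Context {R : realType} {d : nat}.
Variables (T alpha : R) (beta : nat).
Variables (P : R -> {linear Cb R d -> Cb R d})
  (Q : nat -> nat -> {linear Cb R d -> Cb R d}).
Hypotheses (T_gt0 : 0 < T) (alpha_gt0 : 0 < alpha) (semiP : semigroup P).
Hypotheses (hyp1 : H1 alpha beta T P Q) (hyp2 : H2 T P Q).

Let h n l := step T n l.

Lemma step_ge0 n l : 0 <= h n l.
Proof. by rewrite divr_ge0 ?exprn_ge0 ?ler0n // ltW. Qed.

Lemma iter_semigroup k s f : 0 <= s -> iter k (P s) f = P (k%:R * s) f.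
Proof.
case: semiP => P0 PD s0; elim: k => [|k ih] /=; first by rewrite mul0r P0.
by rewrite ih -natr1 mulrDl mul1r addrC PD //= mulr_ge0.
Qed.

Lemma stepS n l : (0 < n)%N -> h n l = n%:R * h n l.+1.
Proof.
by move=> n0; rewrite /h /step exprS invfM [RHS]mulrCA mulVKf // pnatr_eq0 -lt0n.
Qed.

(** Hence the powers of [P] in the remainder stay at times where stability
    applies. *)
Lemma mulr_step n l k : (k <= n)%N -> k%:R * h n l.+1 <= h n l.
Proof.
have [->|n0] := posnP n; first by rewrite leqn0 => /eqP->; rewrite mul0r step_ge0.
by move=> kn; rewrite (stepS l n0) ler_wpM2r ?step_ge0 // ler_nat.
Qed.

Lemma step_le n l : (0 < n)%N -> h n l <= T.
Proof.
by move=> n0; rewrite ler_pdivrMr ?exprn_gt0 ?ltr0n // ler_peMr ?exprn_ege1 ?ler1n // ltW.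
Qed.

Lemma stability l : exists c : nat -> R, (forall m, 0 <= c m) /\
  forall n m, (0 < n)%N -> forall f,
    (forall k, (k <= n ^ l)%N -> cbnorm m (iter k (Q n l) f) <= c m * cbnorm m f) /\
    (forall t, 0 <= t <= T -> cbnorm m (P t f) <= c m * cbnorm m f).
Proof.
have /choice[c hc] : forall m, exists c : R, 0 < c /\
    forall n, (0 < n)%N -> forall f : Cb R d,
      ((\big[Num.max/0]_(k < (n ^ l).+1) cbnorm m (iter k (Q n l) f))%:E
       + ereal_sup [set (cbnorm m (P t f))%:E | t in [set t : R | (0 <= t <= T)%R]]%classic
         <= (c * cbnorm m f)%:E)%E.
  by move=> m; have [c c0 hc] := hyp2 l m; exists c.
exists c; split=> [m|n m n0 f]; first by have [/ltW] := hc m.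
have [_ /(_ n n0 f)] := hc m.
set M := \big[_/_]_(_ < _) _; set S := ereal_sup _ => hMS.
have M0 : 0 <= M by exact: bigmax_ge_id.
have St t : 0 <= t <= T -> ((cbnorm m (P t f))%:E <= S)%E.
  by move=> tT; apply: ereal_sup_ubound; exists t.
have S0 : (0%:E <= S)%E.
  by apply: le_trans (St 0 _); rewrite ?lee_fin ?cbnorm_ge0 // lexx ltW.
split=> [k kn|t tT]; rewrite -lee_fin; apply: le_trans hMS.
  apply: (@le_trans _ _ M%:E); last by rewrite leeDl.
  rewrite lee_fin.
  exact: (le_bigmax _ (fun k : 'I_(n ^ l).+1 => cbnorm m (iter k (Q n l) f))
            (Ordinal (kn : (k < _.+1)%N))).
by apply: le_trans (St t tT) _; rewrite leeDr // lee_fin.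
Qed.

Lemma step_powR n l : (0 < n)%N ->
  h n l.+1 `^ (1 + alpha) = T `^ (1 + alpha) * local_order alpha n l.
Proof.
move=> n0; rewrite /h /step powRM ?invr_ge0 ?exprn_ge0 ?ler0n ?ltW //; congr (_ * _).
by rewrite powR_natN // -powRrM /local_order; congr (_ `^ _); ring.
Qed.

Lemma consistency l : exists c : nat -> R, (forall m, 0 <= c m) /\
  forall n m f, (0 < n)%N ->
    cbnorm m (P (h n l.+1) f - Q n l.+1 f) <=
    c m * local_order alpha n l * cbnorm (m + beta) f.
Proof.
have /choice[c hc] : forall m, exists c : R, 0 < c /\
    forall n, (0 < n)%N -> forall f : Cb R d,
      cbnorm m (P (step T n l.+1) f - Q n l.+1 f)
        <= c * cbnorm (m + beta) f * step T n l.+1 `^ (1 + alpha).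
  by move=> m; have [c c0 hc] := hyp1 l.+1 m; exists c.
exists (fun m => c m * T `^ (1 + alpha)); split=> [m|n m f n0].
  by have [/ltW c0 _] := hc m; rewrite mulr_ge0 ?powR_ge0.
have [_ /(_ n n0 f)] := hc m; rewrite -/(h n l.+1) step_powR // => /le_trans; apply.
by rewrite le_eqVlt; apply/orP; left; apply/eqP; ring.
Qed.

Definition tree_error n l nu (f : Cb R d) : Cb R d :=
  Q n l f + correction n (Q n) l (treeT alpha l nu) f - P (h n l) f.

(** Quantified over all norms, because the letters of a word lose derivatives
    one after the other. *)
Definition converges l nu : Prop := forall m, exists2 C : R, 0 < C &
  forall n, (0 < n)%N -> forall f,
    cbnorm m (tree_error n l nu f) <=
    C * cbnorm (m + kval alpha beta l nu) f * n%:R ^- nu.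

Let D n l (f : Cb R d) : Cb R d := P (h n l) f - Q n l f.

Lemma D_additive n l : @zmod_morphism (Cb R d) (Cb R d) (D n l).
Proof. by move=> x y; rewrite /D (linearB (P _)) (linearB (Q _ _)) !opprD !opprK addrACA. Qed.

Lemma Q_additive n l : @zmod_morphism (Cb R d) (Cb R d) (Q n l).
Proof. by move=> x y; rewrite raddfB. Qed.

(** The words of the remainder have [mval] letters [D], each of which uses [beta]
    derivatives. *)
Lemma remainder_bound l nu m : exists2 C : R, 0 < C &
  forall n, (0 < n)%N -> forall f,
    cbnorm m (\sum_(t < n.+1) iter (n - t) (P (h n l.+1))
      (words (Q n l.+1) (D n l.+1) f (mval alpha l nu) t)) <=
    C * cbnorm (m + kval alpha beta l nu) f * n%:R ^- nu.
Proof.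
have [cq [cq0 hq]] := stability l.+1; have [cD [cD0 hD]] := consistency l.
set M := mval alpha l nu; have w0 := words_cst_ge0 beta cq0 cD0 M m.
exists (cq m * words_cst beta cq cD M m + 1) => [|n n0 f].
  by rewrite ltr_wpDl // mulr_ge0.
have nl k : (k <= n)%N -> (k <= n ^ l.+1)%N.
  by move=> /leq_trans; apply; rewrite expnS leq_pmulr // expn_gt0 n0.
have e0 : 0 <= local_order alpha n l by rewrite ltW // local_order_gt0.
have bq i k g : (k <= n)%N -> cbnorm i (iter k (Q n l.+1) g) <= cq i * cbnorm i g.
  by move=> kn; have [+ _] := hq n i n0 g; apply; exact: nl.
apply: le_trans (ler_cbnorm_sum _ _ _ _) _.
apply: (@le_trans _ _ (\sum_(t < n.+1) cq m *
    cbnorm m (words (Q n l.+1) (D n l.+1) f M t))).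
  apply: ler_sum => t _; rewrite iter_semigroup ?step_ge0 //.
  have [_] := hq n m n0 (words (Q n l.+1) (D n l.+1) f M t); apply.
  rewrite mulr_ge0 ?step_ge0 //= (le_trans (mulr_step _ _)) ?step_le //.
  exact: leq_subr.
rewrite -mulr_sumr.
have /(ler_wpM2l (cq0 m)) := words_bound cq0 cD0 e0 bq (fun m g => hD n m g n0) f M m.
move=> /le_trans; apply; rewrite -[leRHS]mulrA [X in _ <= _ * X]mulrC.
rewrite mulrA [X in X * _]mulrA -mulrA.
apply: le_cst; rewrite ?mulr_ge0 ?exprn_ge0 ?mulr_ge0 ?cbnorm_ge0 //.
apply: ler_pM; rewrite ?exprn_ge0 ?mulr_ge0 ?cbnorm_ge0 ?remainder_order //.
by apply: cbnorm_le; rewrite leq_add2l mulnC kval_ge_remainder.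
Qed.

(** The hypothesis at level [l + 1] says that the correction [B] approximates
    [D]: the error of the tree at that level is [B - D]. *)
Lemma son_bound l nu i m : (0 < i < mval alpha l nu)%N ->
  converges l.+1 (qidx alpha l nu i) -> exists2 C : R, 0 < C &
  forall n, (0 < n)%N -> forall f,
    cbnorm m (\sum_(t < n.+1)
      (iter (n - t) (Q n l.+1) (words (Q n l.+1)
         (correction n (Q n) l.+1 (treeT alpha l.+1 (qidx alpha l nu i))) f i t) -
       iter (n - t) (Q n l.+1) (words (Q n l.+1) (D n l.+1) f i t))) <=
    C * cbnorm (m + kval alpha beta l nu) f * n%:R ^- nu.
Proof.
move=> im hconv; set r := qidx alpha l nu i; set kappa := kval alpha beta l.+1 r.
have [cq [cq0 hq]] := stability l.+1; have [cD [cD0 hD]] := consistency l.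
have /choice[cE hcE] : forall m, exists C : R, 0 < C /\
    forall n, (0 < n)%N -> forall f,
      cbnorm m (tree_error n l.+1 r f) <= C * cbnorm (m + kappa) f * n%:R ^- r.
  by move=> k; have [C C0 hC] := hconv k; exists C.
have cE0 k : 0 <= cE k by have [/ltW] := hcE k.
(* [B] is [D] plus an error of size at most that of [D]: one constant serves
   for both letters. *)
pose cB k := cD k + cE k; have cB0 k : 0 <= cB k by rewrite addr_ge0.
have dc0 := diff_cst_ge0 kappa cq0 cB0 cE0 i m.
exists (cq m * diff_cst kappa cq cB cE i m + 1) => [|n n0 f].
  by rewrite ltr_wpDl // mulr_ge0.
have nl k : (k <= n)%N -> (k <= n ^ l.+1)%N.
  by move=> /leq_trans; apply; rewrite expnS leq_pmulr // expn_gt0 n0.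
have e0 := local_order_gt0 alpha n0 l; have e0' := ltW e0.
have d0 : 0 <= n%:R ^- r :> R by rewrite invr_ge0 exprn_ge0.
have r0 : (0 < r)%N by have [] := qidx_ceil alpha_gt0 im.
have bq j k g : (k <= n)%N -> cbnorm j (iter k (Q n l.+1) g) <= cq j * cbnorm j g.
  by move=> kn; have [+ _] := hq n j n0 g; apply; exact: nl.
have bD' j g : cbnorm j (D n l.+1 g) <=
    cD j * local_order alpha n l * cbnorm (j + kappa) g.
  apply: le_trans (hD n j g n0) _; rewrite ler_wpM2l ?mulr_ge0 //.
  by apply: cbnorm_le; rewrite leq_add2l kval_ge_beta.
set B := correction n (Q n) l.+1 (treeT alpha l.+1 r).
have bBD j g : cbnorm j (B g - D n l.+1 g) <=
    cE j * n%:R ^- r * cbnorm (j + kappa) g.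
  have [_ /(_ n n0 g)] := hcE j; rewrite mulrAC; apply: le_trans.
  by rewrite /tree_error /D opprB addrCA addrA.
have bD j g : cbnorm j (D n l.+1 g) <=
    cB j * local_order alpha n l * cbnorm (j + kappa) g.
  apply: le_trans (bD' j g) _; rewrite ler_wpM2r ?cbnorm_ge0 // ler_wpM2r //.
  by rewrite lerDl.
have bB j g : cbnorm j (B g) <=
    cB j * local_order alpha n l * cbnorm (j + kappa) g.
  rewrite -[B g](subrK (D n l.+1 g)) addrC /cB 2!mulrDl.
  apply: le_trans (ler_cbnormD _ _ _) _; apply: lerD; first exact: bD'.
  apply: le_trans (bBD j g) _; rewrite ler_wpM2r ?cbnorm_ge0 // ler_wpM2l //.
  exact: son_local_order.
apply: le_trans (ler_cbnorm_sum _ _ _ _) _.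
apply: (@le_trans _ _ (\sum_(t < n.+1) cq m *
    cbnorm m (words (Q n l.+1) B f i t - words (Q n l.+1) (D n l.+1) f i t))).
  apply: ler_sum => t _.
  by rewrite -(zmod_morph_iter _ (@Q_additive n l.+1)) bq // leq_subr.
rewrite -mulr_sumr.
have := words_diff_bound cq0 cB0 e0' bq bB cE0 d0 (@Q_additive n l.+1)
  (@D_additive n l.+1) bD bBD f i m.
move: (\sum_(_ < _) _) => S hS.
have {}hS : S <= diff_cst kappa cq cB cE i m * (n%:R ^- nu * cbnorm (m + i * kappa) f).
  rewrite -(ler_pM2l e0); apply: le_trans hS _.
  rewrite [leRHS]mulrCA -2![leLHS]mulrA ler_wpM2l // !mulrA ler_wpM2r ?cbnorm_ge0 //.
  exact: son_order.
apply: le_trans (ler_wpM2l (cq0 m) hS) _.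
rewrite mulrA -[leRHS]mulrA [X in _ <= _ * X]mulrC.
apply: le_cst; rewrite ?mulr_ge0 ?invr_ge0 ?exprn_ge0 ?cbnorm_ge0 //.
rewrite ler_wpM2l ?invr_ge0 ?exprn_ge0 //.
by apply: cbnorm_le; rewrite leq_add2l kval_ge_son.
Qed.

Lemma step_semigroup n l f : (0 < n)%N -> P (h n l) f = iter n (P (h n l.+1)) f.
Proof. by move=> n0; rewrite iter_semigroup ?step_ge0 // -stepS. Qed.

Lemma correction_treeT n l nu f :
  correction n (Q n) l (treeT alpha l nu) f = iter n (Q n l.+1) f - Q n l f +
  \sum_(1 <= i < mval alpha l nu) \sum_(t < n.+1) iter (n - t) (Q n l.+1)
    (words (Q n l.+1)
       (correction n (Q n) l.+1 (treeT alpha l.+1 (qidx alpha l nu i))) f i t).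
Proof.
have tS j : (0 < j <= (mval alpha l nu).-1)%N ->
    is_tree (treeT alpha l.+1 (qidx alpha l nu j)) by move=> _; exact: treeT_is_tree.
rewrite (correction_eq n (@Q_additive n)); last exact: treeT_is_tree.
rewrite treeT_joint // (nsons_joint tS); congr (_ + _).
case: (mval alpha l nu) => [|M]; first by rewrite !big_geq.
apply: eq_big_nat => i hi; apply: eq_bigr => t _.
by rewrite subtree_joint.
Qed.

Lemma tree_error_eq n l nu f : (0 < n)%N -> (0 < nu)%N ->
  tree_error n l nu f =
  \sum_(1 <= i < mval alpha l nu) \sum_(t < n.+1)
    (iter (n - t) (Q n l.+1) (words (Q n l.+1)
       (correction n (Q n) l.+1 (treeT alpha l.+1 (qidx alpha l nu i))) f i t) -
     iter (n - t) (Q n l.+1) (words (Q n l.+1) (D n l.+1) f i t)) -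
  \sum_(t < n.+1) iter (n - t) (P (h n l.+1))
    (words (Q n l.+1) (D n l.+1) f (mval alpha l nu) t).
Proof.
move=> n0 nu0; have M0 : (0 < mval alpha l nu)%N by rewrite lt_mval // mul0r ltr0n.
rewrite /tree_error correction_treeT step_semigroup // addrA [Q n l f + _]addrC subrK.
have Pa : @zmod_morphism (Cb R d) (Cb R d) (P (h n l.+1)).
  by move=> x y; rewrite linearB.
rewrite (@iter_perturbation _ _ (Q n l.+1) n (mval alpha l nu) f Pa (@Q_additive n l.+1)).
rewrite -/(D n l.+1) opprD addrA; congr (_ - _).
rewrite (big_ltn M0) (sum_words0 _ _ _ _ (@Q_additive n l.+1)).
rewrite opprD addrACA subrr add0r -sumrB.
by apply: eq_bigr => i _; rewrite sumrB.
Qed.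

(** For [nu = 0] the expansion would be stopped before its first word; here
    stability alone suffices. *)
Lemma converges0 l : converges l 0.
Proof.
move=> m; have [cq [cq0 hq]] := stability l.+1.
have M0 : mval alpha l 0 = 0%N by apply/eqP; rewrite -leqn0 leqNgt lt_mval // mul0r ltxx.
exists (cq m + cq m + 1) => [|n n0 f]; first by rewrite ltr_wpDl // addr_ge0.
rewrite /tree_error correction_treeT M0 big_geq // addr0 [Q n l f + _]addrC subrK.
have [hQ hP] := hq n m n0 f.
apply: le_trans (ler_cbnormB _ _ _) _.
rewrite expr0 invr1 mulr1; apply: (@le_trans _ _ ((cq m + cq m) * cbnorm m f)).
  rewrite mulrDl lerD ?hQ ?hP ?step_ge0 ?step_le //.
  by rewrite expnS leq_pmulr // expn_gt0 n0.
by apply: le_cst; rewrite ?addr_ge0 ?cbnorm_ge0 ?cbnorm_le ?leq_addr.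
Qed.

Lemma converges_sons l nu :
  (forall i, (0 < i < mval alpha l nu)%N -> converges l.+1 (qidx alpha l nu i)) ->
  converges l nu.
Proof.
have [->|nu0] := posnP nu; first by move=> _; exact: converges0.
move=> hsons m; have [Cr Cr0 hr] := remainder_bound l nu m.
have /choice[c hc] : forall i, exists C : R, 0 <= C /\
    ((0 < i < mval alpha l nu)%N -> forall n, (0 < n)%N -> forall f,
    cbnorm m (\sum_(t < n.+1)
      (iter (n - t) (Q n l.+1) (words (Q n l.+1)
         (correction n (Q n) l.+1 (treeT alpha l.+1 (qidx alpha l nu i))) f i t) -
       iter (n - t) (Q n l.+1) (words (Q n l.+1) (D n l.+1) f i t))) <=
    C * (cbnorm (m + kval alpha beta l nu) f * n%:R ^- nu)).
  move=> i; case im: (0 < i < mval alpha l nu)%N; last by exists 0.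
  have [C C0 hC] := son_bound m im (hsons i im); exists C; split; first exact: ltW.
  by move=> _ n n0 f; rewrite mulrA; exact: hC.
exists (\sum_(1 <= i < mval alpha l nu) c i + Cr) => [|n n0 f].
  by rewrite ltr_wpDl // sumr_ge0 // => i _; have [] := hc i.
rewrite tree_error_eq // -mulrA mulrDl; apply: le_trans (ler_cbnormB _ _ _) _.
apply: lerD; last by rewrite mulrA; exact: hr.
rewrite mulr_suml; apply: le_trans (ler_cbnorm_sum _ _ _ _) _.
rewrite big_nat [leRHS]big_nat; apply: ler_sum => i im.
by have [_] := hc i; apply.
Qed.

(** Each level adds at most one to [nu], so that [nu - l] does not increase,
    whereas [alpha * l] does; the induction is on the number of levels left until
    [nu <= l + alpha * (l + 1)], when the root has no son. *)
Lemma converges_all l nu : converges l nu.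
Proof.
have [k] : exists k : nat, nu%:R <= l%:R + alpha * (l + k).+1%:R.
  exists (Num.bound (nu%:R / alpha)).
  have : nu%:R / alpha < (Num.bound (nu%:R / alpha))%:R.
    by apply: archi_boundP; rewrite divr_ge0 ?ler0n // ltW.
  rewrite ltr_pdivrMr // mulrC => /ltW/le_trans; apply.
  rewrite -addSn natrD mulrDr addrA lerDr addr_ge0 ?ler0n // mulr_ge0 ?ler0n //.
  exact: ltW.
elim: k l nu => [|k ih] l nu hk; apply: converges_sons => i im.
  case/andP: im => i0; rewrite lt_mval // => im; exfalso.
  have i1 : 1 <= i%:R :> R by rewrite ler1n.
  have l0 := ler0n R l; move: hk im; rewrite addn0 -natr1.
  have : (1 + alpha) * l%:R + alpha <= i%:R * ((1 + alpha) * l%:R + alpha).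
    have a0 := ltW alpha_gt0; apply: ler_peMl => //.
    by rewrite addr_ge0 // mulr_ge0 // addr_ge0.
  by lra.
apply: ih; have := qidx_le alpha_gt0 im; rewrite -(ler_nat R) => /le_trans; apply.
by move: hk; rewrite addSnnS -!(natr1 nu) -!(natr1 l); lra.
Qed.

End Convergence.

Theorem theorem3p10 (R : realType) (d : nat) (T alpha : R) (beta nu : nat)
    (P : R -> {linear Cb R d -> Cb R d})
    (Q : nat -> nat -> {linear Cb R d -> Cb R d}) :
  0 < T -> 0 < alpha -> semigroup P ->
  H1 alpha beta T P Q -> H2 T P Q ->
  exists2 C : R, 0 < C &
    forall n : nat, (0 < n)%N ->
    (\max_(u <- treeT alpha 0 nu) nsons (treeT alpha 0 nu) u <= n)%N ->
    forall f : Cb R d,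
      cbnorm 0 (Qhat n (fun l => Q n l) (treeT alpha 0 nu) f - P T f)
        <= C * cbnorm (kval alpha beta 0 nu) f * n%:R ^- nu.
Proof.
move=> T0 a0 semiP h1 h2.
have [C C0 hC] := converges_all T0 a0 semiP h1 h2 0 nu 0.
exists C => // n n0 _ f; have := hC n n0 f.
by rewrite /tree_error /step expr0 divr1 add0n -Qhat_correction.
Qed.
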